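(* Let $t \geq 2$ and $2 \leq \ell \leq t$ be integers and let $u = \lceil t/2 \rceil$. Then $$\theta_t(K_{t+\ell}) \geq \frac{1}{2}\left(1 - \frac{1}{\ell}\right) 2^{-u^2}.$$
   Context: For a graph $G$ and an integer $t\ge 2$, the $K_t$-independence number $\alpha_t(G)$ is the maximum size of a set $S\subseteq V(G)$ such that the induced subgraph $G[S]$ contains no copy of $K_t$. For a graph $H$ and a function $f$, $\mathrm{RT}_t(n,H,f(n))$ is the maximum number of edges in an $n$-vertex graph $G$ that contains no copy of $H$ and satisfies $\alpha_t(G)\le f(n)$. Define $$\theta_t(H) = \lim_{\epsilon\to 0}\lim_{n\to\infty}\frac{1}{n^2}\mathrm{RT}_t(n,H,\epsilon n).$$ *)

(* Defs.v *)
From HB Require Import structures.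
From mathcomp Require Import all_boot all_order all_algebra.

Set Implicit Arguments.
Unset Strict Implicit.
Unset Printing Implicit Defensive.

Record sgraph (T : finType) := SGraph {
  edges : {set {set T}};
  edges_card2 : [forall e in edges, #|e| == 2] }.

HB.instance Definition _ (T : finType) := [isSub for @edges T].
HB.instance Definition _ (T : finType) := [Finite of sgraph T by <:].

Lemma complete_card2 n :
  [forall e in [set e : {set 'I_n} | #|e| == 2], #|e| == 2].
Proof. by apply/forall_inP => e; rewrite inE. Qed.

Definition complete n : sgraph 'I_n := SGraph (complete_card2 n).

(* H need not be an induced subgraph of G. *)
Definition contains (U T : finType) (H : sgraph U) (G : sgraph T) : bool :=
  [exists f : {ffun U -> T},
     injectiveb f && [forall e in edges H, f @: e \in edges G]].

Definition induced_edges (T : finType) (G : sgraph T) (S : {set T}) :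
    {set {set {x | x \in S}}} :=
  [set e : {set {x | x \in S}} | val @: e \in edges G].

Lemma induced_card2 (T : finType) (G : sgraph T) (S : {set T}) :
  [forall e in induced_edges G S, #|e| == 2].
Proof.
apply/forall_inP => e; rewrite inE => /(forall_inP (edges_card2 G)).
by rewrite card_imset //; apply: val_inj.
Qed.

Definition induced (T : finType) (G : sgraph T) (S : {set T}) :
  sgraph {x | x \in S} := SGraph (induced_card2 G S).

Definition alpha (t : nat) (T : finType) (G : sgraph T) : nat :=
  \max_(S : {set T} | ~~ contains (complete t) (induced G S)) #|S|.

From mathcomp Require Import all_classical all_reals all_analysis.
Import Order.TTheory GRing.Theory Num.Theory numFieldNormedType.Exports.
Local Open Scope classical_set_scope.
Local Open Scope ring_scope.

(* The maximum over an empty family of graphs is 0. *)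
Definition RT (R : realType) (t n : nat) (U : finType) (H : sgraph U) (x : R)
    : nat :=
  (\max_(G : sgraph 'I_n | ~~ contains H G && ((alpha t G)%:R <= x)%R)
     #|edges G|)%N.

(* [lim] is 0 at a non-convergent filter, so a positive lower bound on [theta]
   entails that the outer limit exists, and the inner one for all small eps. *)
Definition theta (R : realType) (t : nat) (U : finType) (H : sgraph U) : R :=
  lim ((fun eps : R =>
          lim ((fun n : nat => (RT t n H (eps * n%:R))%:R / n%:R ^+ 2 : R)
                 @ \oo))
         @ 0^'+).

(* Main.v *)
Require Import Defs.
From mathcomp Require Import all_boot all_order all_algebra.
From mathcomp Require Import ring lra zify.
From mathcomp Require Import reals.
Set Implicit Arguments.
Unset Strict Implicit.
Unset Printing Implicit Defensive.
Import Order.TTheory GRing.Theory Num.Theory.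
Local Open Scope ring_scope.

(** A Bollobás–Erdős type graph in which a cube replaces the sphere.  Let X be
    the product of d copies of a fine symmetric grid in [-1, 1].  The Poincaré
    inequality tensorizes, so all but a small proportion of X lies within
    Euclidean distance O(1), uniformly in d, of any dense subset, whereas the
    inner product of two random points is symmetric and exceeds any fixed K in
    absolute value with probability tending to 1.

    A vertex is a part in {1, ..., l}, a matrix (x_pq) of points of X indexed by
    u x u, and a word z over an alphabet of t letters.  In distinct parts, x and
    y are adjacent when <x_pq, y_qp> > K for all p, q; this has probability
    about 2^-(u^2).  In one part, x and x' are adjacent when for some p all the
    sums x_pq + x'_pq have squared norm at most K, and the words agree in a
    small proportion of the positions.  By pigeonhole on the letters a clique
    has at most t vertices in a part.  If it had two vertices x, x' in a part
    and two, y, y', in another, then for suitable p and q the inner product of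
    x_pq + x'_pq and y_qp + y'_qp would be at most K by AM-GM, but more than 4K
    as a sum of four cross terms.  So there is no clique of size t + l.  As
    t <= 2^u, there are t distinct sign vectors of length u; applying to a
    dense set A of vertices of a part the t sign changes (of all the x_pq with
    p fixed) coupled with the t cyclic shifts of the alphabet gives t dense
    sets, all close to a common point, and hence a clique of size t in A.

    Both limits exist: blowing up shows that for fixed eps the inner sequence
    converges to its supremum, and this supremum is nondecreasing in eps. *)

(** * Poincaré inequalities for transport costs *)

Section Poincare.
Variable R : realFieldType.

Lemma sum_pair (X Y : finType) (F : X * Y -> R) :
  \sum_p F p = \sum_x \sum_y F (x, y).
Proof. by rewrite pair_bigA; apply: eq_bigr => -[]. Qed.

Lemma sum_const (X : finType) (a : R) : \sum_(x : X) a = #|X|%:R * a.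
Proof. by rewrite sumr_const mulr_natl. Qed.

(** Equal to [2 * #|X| ^ 2] times the variance of [f] under the uniform measure. *)
Definition variation (X : finType) (f : X -> R) : R :=
  \sum_x \sum_y (f x - f y) ^+ 2.

(* Used with f x = min c x b over b in a set, attained at a x; unlike that case,
   the one-sided bound is inherited by the sections of f on a product. *)
Definition poincare (X : finType) (c : X -> X -> R) (k1 k2 : R) : Prop :=
  forall (f : X -> R) (a : X -> X),
    (forall x y, f y - f x <= c y (a x) - c x (a x)) ->
    variation f <= #|X|%:R * \sum_x (k1 * c x (a x) + k2).

Lemma poincare_weaken (X : finType) (c : X -> X -> R) k1 k2 k1' k2' :
  (forall x y, 0 <= c x y) -> k1 <= k1' -> k2 <= k2' ->
  poincare c k1 k2 -> poincare c k1' k2'.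
Proof.
move=> c0 h1 h2 P f a fa; apply: le_trans (P f a fa) _.
apply: ler_wpM2l => //; apply: ler_sum => x _.
by apply: lerD => //; apply: ler_wpM2r.
Qed.

(** The Efron-Stein inequality, unnormalized. Both sides are doubled and expanded over quadruples x,
    x', y, y', with one pair of variables exchanged in the second copies, so that the summands
    compare pointwise. *)
Lemma variation_prod (X Y : finType) (f : X * Y -> R) :
  variation f <= #|Y|%:R * (\sum_y variation (fun x => f (x, y)))
               + #|X|%:R * (\sum_x variation (fun y => f (x, y))).
Proof.
pose s (F : X -> X -> Y -> Y -> R) := \sum_x \sum_x' \sum_y \sum_y' F x x' y y'.
have sD F G : s (fun x x' y y' => F x x' y y' + G x x' y y') = s F + s G.
  rewrite /s -big_split; apply: eq_bigr => x _ /=.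
  rewrite -big_split; apply: eq_bigr => x' _ /=.
  rewrite -big_split; apply: eq_bigr => y _ /=.
  by rewrite -big_split.
have sC F : s F = s (fun x x' y y' => F x x' y' y).
  by apply: eq_bigr => x _; apply: eq_bigr => x' _; rewrite exchange_big.
have e1 : variation f = s (fun x x' y y' => (f (x, y) - f (x', y')) ^+ 2).
  rewrite /variation sum_pair; apply: eq_bigr => x _.
  by under eq_bigr do rewrite sum_pair; rewrite exchange_big.
have e2 := sC (fun x x' y y' => (f (x, y) - f (x', y')) ^+ 2).
have e3 : #|Y|%:R * (\sum_y variation (fun x => f (x, y))) =
          s (fun x x' y y' => (f (x, y) - f (x', y)) ^+ 2).
  have -> : \sum_y variation (fun x => f (x, y)) =
            \sum_x \sum_x' \sum_y (f (x, y) - f (x', y)) ^+ 2.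
    rewrite exchange_big; apply: eq_bigr => x _; exact: exchange_big.
  rewrite big_distrr; apply: eq_bigr => x _ /=.
  rewrite big_distrr; apply: eq_bigr => x' _ /=.
  by rewrite big_distrr; apply: eq_bigr => y _; rewrite /= sum_const.
have e4 := sC (fun x x' y y' => (f (x, y) - f (x', y)) ^+ 2).
have e5 : #|X|%:R * (\sum_x variation (fun y => f (x, y))) =
          s (fun x x' y y' => (f (x, y) - f (x, y')) ^+ 2).
  by rewrite big_distrr; apply: eq_bigr => x _; rewrite /= sum_const.
have e6 : s (fun x x' y y' => (f (x, y) - f (x, y')) ^+ 2) =
          s (fun x x' y y' => (f (x', y) - f (x', y')) ^+ 2).
  by rewrite /s exchange_big.
suff : variation f *+ 2 <=
   (#|Y|%:R * (\sum_y variation (fun x => f (x, y)))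
     + #|X|%:R * (\sum_x variation (fun y => f (x, y)))) *+ 2.
  by rewrite lerMn2r.
rewrite !mulr2n {1}e1 {1}e1 {2}e2 e3 e5 -/(s _).
rewrite addrACA {2}e4 {2}e6 -!sD.
apply: ler_sum => x _; apply: ler_sum => x' _.
apply: ler_sum => y _; apply: ler_sum => y' _.
(* the difference of the two sides is the square of the mixed second difference *)
have := sqr_ge0 (f (x, y) - f (x', y) - f (x, y') + f (x', y')).
nra.
Qed.

(** Between two points that share a coordinate the cost in that coordinate cancels, so the sections
    of [f] inherit the one-sided bound. The factor [k] does not grow; only the error terms add
    up. *)
Lemma poincare_prod (X Y : finType) (cX : X -> X -> R) (cY : Y -> Y -> R)
    k kX kY :
  poincare cX k kX -> poincare cY k kY ->
  poincare (fun p q : X * Y => cX p.1 q.1 + cY p.2 q.2) k (kX + kY).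
Proof.
move=> PX PY f a fa; apply: le_trans (variation_prod f) _.
have hX y : variation (fun x => f (x, y)) <=
    #|X|%:R * \sum_x (k * cX x (a (x, y)).1 + kX).
  apply: (PX (fun x => f (x, y)) (fun x => (a (x, y)).1)) => x x'.
  by have := fa (x, y) (x', y) => /=; lra.
have hY x : variation (fun y => f (x, y)) <=
    #|Y|%:R * \sum_y (k * cY y (a (x, y)).2 + kY).
  apply: (PY (fun y => f (x, y)) (fun y => (a (x, y)).2)) => y y'.
  by have := fa (x, y) (x, y') => /=; lra.
have hX' := @ler_sum _ _ (index_enum Y) predT _ _ (fun y _ => hX y).
have hY' := @ler_sum _ _ (index_enum X) predT _ _ (fun x _ => hY x).
apply: le_trans (lerD (ler_wpM2l (ler0n _ _) hX') (ler_wpM2l (ler0n _ _) hY')) _.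
rewrite card_prod natrM sum_pair -!big_distrr /= [X in _ * (_ * X) + _]exchange_big /=.
rewrite !mulrA [#|Y|%:R * _]mulrC -mulrDr -big_split /=.
rewrite le_eqVlt; apply/orP; left; apply/eqP; congr (_ * _).
apply: eq_bigr => x _; rewrite -big_split; apply: eq_bigr => y _ /=; ring.
Qed.

Lemma poincare_bij (X Y : finType) (h : X -> Y) (cX : X -> X -> R)
    (cY : Y -> Y -> R) k1 k2 :
  bijective h -> (forall x x', cX x x' = cY (h x) (h x')) ->
  poincare cY k1 k2 -> poincare cX k1 k2.
Proof.
move=> [g hK gK] cE P f a fa.
have := P (f \o g) (h \o a \o g); rewrite -(bij_eq_card (Bijective hK gK)).
have E (F : X -> R) : \sum_x F x = \sum_y F (g y).
  by rewrite (reindex g) //; exists h => ? _; rewrite ?hK ?gK.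
rewrite /variation E; under [X in _ -> X <= _]eq_bigr do rewrite E.
rewrite (E (fun x => _ * _ + _)) => H.
apply: le_trans (H _) _; last first.
  apply: ler_wpM2l => //; apply: ler_sum => y _ /=.
  by rewrite cE gK.
move=> y y' /=; have := fa (g y) (g y'); by rewrite !cE !gK.
Qed.

Definition fcons (T : Type) n (f : {ffun 'I_n.+1 -> T}) : T * {ffun 'I_n -> T} :=
  (f ord0, [ffun i => f (lift ord0 i)]).

Lemma fcons_bij (T : Type) n : bijective (@fcons T n).
Proof.
exists (fun p : T * {ffun 'I_n -> T} =>
  [ffun i => if unlift ord0 i is Some j then p.2 j else p.1]).
  move=> f; apply/ffunP => i; rewrite ffunE.
  by case: unliftP => [j|] ->; rewrite ?ffunE.
case=> x f; rewrite /fcons !ffunE unlift_none; congr (_, _).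
by apply/ffunP => i; rewrite !ffunE liftK.
Qed.

Lemma poincare_ffun (J X : finType) (c : X -> X -> R) k1 k2 :
  poincare c k1 k2 ->
  poincare (fun f g : {ffun J -> X} => \sum_j c (f j) (g j)) k1 (#|J|%:R * k2).
Proof.
move=> P.
have Pn n : poincare (fun f g : {ffun 'I_n -> X} => \sum_j c (f j) (g j))
              k1 (n%:R * k2).
  elim: n => [|n IHn].
    move=> f a _; rewrite /variation big1 => [|x _]; last first.
      rewrite big1 // => y _; suff -> : x = y by rewrite subrr expr0n.
      by apply/ffunP => -[].
    apply: mulr_ge0 => //; apply: sumr_ge0 => x _.
    by rewrite big_ord0 mul0r mulr0 addr0.
  have -> : n.+1%:R * k2 = k2 + n%:R * k2 by rewrite -natr1 mulrDl mul1r addrC.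
  apply: (poincare_bij (fcons_bij X n)) (poincare_prod P IHn) => f g /=.
  by rewrite big_ord_recl; congr (_ + _); apply: eq_bigr => i _; rewrite !ffunE.
pose h (f : {ffun J -> X}) : {ffun 'I_#|J| -> X} := [ffun i => f (enum_val i)].
have hb : bijective h.
  exists (fun f : {ffun 'I_#|J| -> X} =>
    [ffun j => f (enum_rank j)] : {ffun J -> X}) => f; apply/ffunP => j.
    by rewrite !ffunE enum_rankK.
  by rewrite !ffunE enum_valK.
apply: (poincare_bij hb) (Pn #|J|) => f g.
rewrite (reindex (@enum_val J predT)) /=; last first.
  by exists enum_rank => j _; rewrite ?enum_valK ?enum_rankK.
by apply: eq_bigr => i _; rewrite !ffunE.
Qed.

Lemma poincare_hamming (X : finType) (k : R) : 0 <= k ->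
  poincare (fun x y : X => k * (x != y)%:R) 0 (k ^+ 2).
Proof.
move=> k0 f a fa; under [in leRHS]eq_bigr do rewrite mul0r add0r.
rewrite -sum_const; apply: ler_sum => x _; apply: ler_sum => y _.
have H u v : f v - f u <= k.
  apply: le_trans (fa u v) _; case: (_ != _); case: (_ != _) => /=; nra.
by have := H x y; have := H y x; nra.
Qed.

Lemma double_mul_sum_le (I : Type) (s : seq I) (F : I -> R) (a : R) :
  2 * (a * \sum_(i <- s) F i) <=
    (size s)%:R * a ^+ 2 + \sum_(i <- s) F i ^+ 2.
Proof.
elim: s => [|i s IHs]; first by rewrite !big_nil /=; nra.
rewrite !big_cons /= -natr1; have := sqr_ge0 (a - F i); nra.
Qed.

Lemma sqr_sum_le (I : Type) (s : seq I) (F : I -> R) :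
  (\sum_(i <- s) F i) ^+ 2 <= (size s)%:R * \sum_(i <- s) F i ^+ 2.
Proof.
elim: s => [|i s IHs]; first by rewrite !big_nil; nra.
have := double_mul_sum_le s F (F i).
rewrite !big_cons /= -natr1; nra.
Qed.

(** An increment of [f] between neighbours is controlled by the derivative of the squared distance,
    whose square is again a multiple of the cost; Cauchy-Schwarz along the path then bounds all
    differences. The error 4/m^2 comes from the discretization. *)
Lemma poincare_grid (m : nat) :
  poincare (fun i j : 'I_m => (i%:R - j%:R) ^+ 2 / m%:R ^+ 2) 16 (4 / m%:R ^+ 2).
Proof.
case: m => [|n] f a fa.
  by rewrite card_ord mul0r /variation big_ord0.
set m : R := n.+1%:R in fa *; have m0 : 0 < m by rewrite ltr0n.
pose v (k : nat) : R := k%:R - (a (inord k) : nat)%:R.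
(* The numerator bounds (1 + 2v)^2 and (1 - 2v)^2. A rise of [f] from k to k + 1 is bounded through
   the point chosen for k, a fall through the point chosen for k + 1. *)
pose B (k : nat) : R := (8 * v k ^+ 2 + 2) / m ^+ 4.
pose G (k : nat) : R := f (inord k).
have B0 k : 0 <= B k.
  by rewrite divr_ge0 ?exprn_ge0 ?(ltW m0) //; have := sqr_ge0 (v k); nra.
have dB k : (k < n)%N -> (G k.+1 - G k) ^+ 2 <= B k + B k.+1.
  move=> kn; have k1 : (inord k : 'I_n.+1) = k :> nat by rewrite inordK //; lia.
  have k2 : (inord k.+1 : 'I_n.+1) = k.+1 :> nat by rewrite inordK.
  have h1 : (G k.+1 - G k) * m ^+ 2 <= 2 * v k + 1.
    rewrite -ler_pdivlMr ?exprn_gt0 //; apply: le_trans (fa _ _) _.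
    rewrite k1 k2 -mulrBl ler_pM2r ?invr_gt0 ?exprn_gt0 // -natr1 /v; nra.
  have h2 : (G k - G k.+1) * m ^+ 2 <= 1 - 2 * v k.+1.
    rewrite -ler_pdivlMr ?exprn_gt0 //; apply: le_trans (fa _ _) _.
    rewrite k1 k2 -mulrBl ler_pM2r ?invr_gt0 ?exprn_gt0 // /v -natr1; nra.
  rewrite -mulrDl ler_pdivlMr ?exprn_gt0 //.
  have -> : (G k.+1 - G k) ^+ 2 * m ^+ 4 = ((G k.+1 - G k) * m ^+ 2) ^+ 2 by ring.
  move: h1 h2; rewrite -opprB mulNr; set D := (_ * m ^+ 2).
  by case: (lerP 0 D) => ? ? ?; have := sqr_ge0 (2 * v k - 1);
    have := sqr_ge0 (2 * v k.+1 + 1); nra.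
have sumB : \sum_(0 <= k < n) (G k.+1 - G k) ^+ 2 <= 2 * \sum_(0 <= k < n.+1) B k.
  apply: (@le_trans _ _ (\sum_(0 <= k < n) (B k + B k.+1))).
    by apply: ler_sum_nat => k /andP[_]; apply: dB.
  rewrite big_split /= mulrDl mul1r; apply: lerD.
    by rewrite big_nat_recr //= lerDl.
  by rewrite big_nat_recl //= lerDr.
have le_xy (x y : 'I_n.+1) : (x <= y)%N ->
    (f x - f y) ^+ 2 <= m * (2 * \sum_(0 <= k < n.+1) B k).
  move=> xy; have -> : f x - f y = - \sum_(x <= k < y) (G k.+1 - G k).
    by rewrite telescope_sumr // opprB /G !inord_val.
  rewrite sqrrN; apply: le_trans (sqr_sum_le _ _) _.
  apply: ler_pM; rewrite ?sumr_ge0 // ?size_iota ?ler_nat.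
  - by move=> *; apply: sqr_ge0.
  - by have := ltn_ord y; lia.
  apply: le_trans sumB.
  have yn : (y <= n)%N by have := ltn_ord y; lia.
  have dd k : 0 <= (G k.+1 - G k) ^+ 2 by apply: sqr_ge0.
  rewrite [leRHS](big_cat_nat (leq0n x) (leq_trans xy yn)) /=.
  rewrite (big_cat_nat xy yn) /= addrCA lerDl.
  by rewrite addr_ge0 // sumr_ge0.
have all_xy (x y : 'I_n.+1) : (f x - f y) ^+ 2 <= m * (2 * \sum_(0 <= k < n.+1) B k).
  by case/orP: (leq_total x y) => /le_xy //; rewrite -sqrrN opprB.
rewrite card_ord -/m big_mkord in all_xy *.
apply: le_trans (ler_sum _ (fun x _ => ler_sum _ (fun y _ => all_xy x y))) _.
rewrite !sum_const card_ord -/m.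
rewrite !big_distrr /=; apply: ler_sum => x _.
rewrite /B /v inord_val le_eqVlt; apply/orP; left; apply/eqP; field.
by rewrite nat1r pnatr_eq0.
Qed.

(** The cost [D] of reaching [A] vanishes on a proportion e of X, so its variation is at least
    2e#|X| times the sum of D^2. The Poincaré inequality bounds it by a linear expression in D,
    AM-GM absorbs the linear term, and Markov's inequality for D^2 concludes. *)
Lemma poincare_concentration (X : finType) (c : X -> X -> R) (k1 k2 e r : R)
    (A : {set X}) :
  poincare c k1 k2 -> (forall x y, 0 <= c x y) -> (forall x, c x x = 0) ->
  0 < e -> 0 <= r -> A != set0 -> e * #|X|%:R <= #|A|%:R ->
  #|[set x | [forall (a | a \in A), r < c x a]]|%:R * (r ^+ 2 * e)
    <= #|X|%:R * (k1 ^+ 2 / (4 * e) + k2).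
Proof.
move=> P c0 cxx e0 r0 /set0Pn[a0 a0A] eA.
pose a x := [arg min_(b < a0 | b \in A) c x b]%O.
have aA x : a x \in A by rewrite /a; case: arg_minP.
have amin x b : b \in A -> c x (a x) <= c x b.
  by rewrite /a; case: arg_minP => // ? _ + bA; apply.
pose D x := c x (a x).
have D0 x : 0 <= D x by apply: c0.
have DA x : x \in A -> D x = 0.
  by move=> xA; apply/le_anti; rewrite D0 andbT -(cxx x) amin.
have X0 : 0 < #|X|%:R :> R by rewrite ltr0n; apply/card_gt0P; exists a0.
have V1 : 2 * (#|A|%:R * \sum_x D x ^+ 2) <= variation D.
  have E : #|A|%:R * \sum_x D x ^+ 2 = \sum_x \sum_y (x \in A)%:R * D y ^+ 2.
    rewrite -sum1_card natr_sum big_distrl big_mkcond /=.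
    apply: eq_bigr => x _; rewrite -big_distrr /=.
    by case: (x \in A); rewrite ?mul0r.
  rewrite mulrDl mul1r {1}E E [X in _ + X]exchange_big -big_split /=.
  apply: ler_sum => x _; rewrite -big_split /=; apply: ler_sum => y _.
  have := sqr_ge0 (D x - D y); move: (DA x) (DA y).
  case: (x \in A) => [/(_ isT)->|_]; case: (y \in A) => [/(_ isT)->|_] /=; nra.
have V2 : variation D <= #|X|%:R * \sum_x (k1 * D x + k2).
  apply: P => x y; rewrite lerD2r; exact: amin.
have V3 : e * \sum_x D x ^+ 2 <= \sum_(x : X) (k1 ^+ 2 / (4 * e) + k2).
  have H : 2 * (e * \sum_x D x ^+ 2) <= \sum_x (k1 * D x + k2).
    rewrite -(ler_pM2l X0); apply: le_trans (le_trans V1 V2).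
    have S0 : 0 <= \sum_x D x ^+ 2 by apply: sumr_ge0 => x _; apply: sqr_ge0.
    by have := ler_wpM2r S0 eA; lra.
  have H' : \sum_x (k1 * D x + k2) <=
      e * \sum_x D x ^+ 2 + \sum_(x : X) (k1 ^+ 2 / (4 * e) + k2).
    rewrite big_distrr -big_split /=; apply: ler_sum => x _.
    rewrite addrA lerD2r -subr_ge0.
    have -> : e * D x ^+ 2 + k1 ^+ 2 / (4 * e) - k1 * D x =
              (2 * e * D x - k1) ^+ 2 / (4 * e) by field; rewrite gt_eqF.
    by rewrite divr_ge0 ?sqr_ge0 // mulr_ge0 // ltW.
  lra.
rewrite -sum_const; apply: le_trans V3.
rewrite mulrA [X in X <= _]mulrC ler_pM2l //.
rewrite -sum1_card natr_sum big_distrl big_mkcond /=; apply: ler_sum => x _.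
case: ifP => [|_]; last exact: sqr_ge0.
rewrite inE => /forall_inP /(_ _ (aA x)); rewrite -/(D x) => rD.
by rewrite mul1r; apply: lerXn2r; rewrite ?nnegrE // ltW.
Qed.

End Poincare.

(** * Anticoncentration of symmetric sums *)

Section Anticoncentration.
Variables (R : archiRealFieldType) (W : finType) (v : W -> R) (inv : W -> W).
Hypothesis invK : involutive inv.
Hypothesis v_inv : forall w, v (inv w) = - v w.
Variables (c rho : R).
Hypothesis c0 : 0 < c.
Hypothesis rho01 : 0 <= rho <= 1.
Hypothesis v_large : rho * #|W|%:R <= #|[set w | c <= `|v w|]|%:R.

Definition in_window (a s : R) : R := (a <= s < a + 2 * c)%R%:R.
Definition window_count n a : R :=
  \sum_(f : {ffun 'I_n -> W}) in_window a (\sum_i v (f i)).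

(** [sorted gap s] encodes a family of pairwise disjoint windows, listed from left to right by their
    left ends. *)
Definition gap : rel R := fun a b => a + 2 * c <= b.

Lemma window_countS n a : window_count n.+1 a = \sum_w window_count n (a - v w).
Proof.
rewrite /window_count pair_bigA /= (reindex (@fcons W n)) /=; last first.
  by apply: onW_bij; apply: fcons_bij.
apply: eq_bigr => f _; rewrite big_ord_recl /= /in_window.
under [\sum_(i < n) v ([ffun _ => _] i)]eq_bigr do rewrite ffunE.
by rewrite lerBlDl addrAC ltrBrDl.
Qed.

Lemma gap_trans : transitive gap.
Proof. by move=> b a d; rewrite /gap; move: c0; lra. Qed.

Lemma sum_in_window_le1 (s : seq R) (x : R) :
  sorted gap s -> \sum_(a <- s) in_window a x <= 1.
Proof.
elim: s => [|a s IHs]; first by rewrite big_nil.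
rewrite /= (path_sortedE gap_trans) => /andP[/allP gap_a /IHs{}IHs].
rewrite big_cons {1}/in_window; case: (boolP (a <= x < _)) => [/andP[_ xa]|_].
  rewrite big_seq big1 ?addr0 // => b /gap_a; rewrite /gap /in_window => ab.
  by rewrite (lt_geF (lt_le_trans xa ab)).
by rewrite add0r.
Qed.

Variable L : nat.
Hypothesis L0 : (0 < L)%N.

Let lam : R := 1 - rho / L%:R ^+ 2.

(** The term k/L is what remains for large [n]. The other term has second difference
    [- 2 * lam ^+ n] in [k], which provides the gain when k + k windows are regrouped as k - 1 and k
    + 1. *)
Definition window_bound k n : R :=
  k%:R / L%:R + lam ^+ n * (k%:R * (2 * L%:R - k%:R)).

Let Lpos : 0 < L%:R :> R. Proof. by rewrite ltr0n. Qed.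

Let lam01 : 0 <= lam <= 1.
Proof.
have L1 : 1 <= L%:R ^+ 2 :> R by rewrite exprn_ege1 // ler1n.
rewrite /lam subr_ge0 ler_pdivrMr ?mul1r ?(lt_le_trans ltr01 L1) //.
have /andP[r0 r1] := rho01.
by rewrite (le_trans r1 L1) /= gerBl divr_ge0 // ltW // (lt_le_trans ltr01 L1).
Qed.

Lemma sum_window_count_le (n : nat) (s : seq R) :
  sorted gap s -> \sum_(a <- s) window_count n a <= #|W|%:R ^+ n.
Proof.
move=> gs; rewrite exchange_big /= -natrX.
have -> : (#|W| ^ n)%N = #|{: {ffun 'I_n -> W}}| by rewrite card_ffun card_ord.
rewrite -[leRHS]mulr1 -sum_const; apply: ler_sum => f _.
exact: sum_in_window_le1.
Qed.

Lemma sorted_gap_shift (t : R) s : sorted gap s -> sorted gap [seq a + t | a <- s].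
Proof.
by rewrite sorted_map; apply: sub_sorted => a b; rewrite /gap /= => ?; rewrite addrAC lerD2r.
Qed.

(* Shift k windows by +V and by -V with V >= c: the leftmost window moved left
   is disjoint from all the windows moved right, which gives families of
   k + 1 and k - 1 disjoint windows. *)
Lemma sum_window_count_bound (n : nat) (s : seq R) :
  sorted gap s -> (size s <= 2 * L)%N ->
  \sum_(a <- s) window_count n a <= #|W|%:R ^+ n * window_bound (size s) n.
Proof.
have /andP[r0 r1] := rho01; have /andP[l0 l1] := lam01.
have Wn0 k : 0 <= #|W|%:R ^+ k :> R by apply: exprn_ge0.
have part0 k n' : (k <= 2 * L)%N -> 0 <= lam ^+ n' * (k%:R * (2 * L%:R - k%:R)).
  by move=> kL; rewrite !mulr_ge0 ?exprn_ge0 // subr_ge0 -natrM ler_nat.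
(* From L windows on, k/L is already at least 1, so disjointness suffices. *)
have few (n' : nat) s' : sorted gap s' -> (L <= size s')%N -> (size s' <= 2 * L)%N ->
    \sum_(a <- s') window_count n' a <= #|W|%:R ^+ n' * window_bound (size s') n'.
  move=> gs Ls szs; apply: le_trans (sum_window_count_le _ gs) _; rewrite ler_peMr //.
  apply: ler_wpDr; first exact: part0.
  by rewrite ler_pdivlMr // mul1r ler_nat.
elim: n s => [|n IHn] s gs szs; case: (leqP L (size s)) => [/few-> //|sL];
  case: s => [|a1 s] in gs szs sL *;
  rewrite ?big_nil ?mulr_ge0 // ?/window_bound ?mul0r ?mulr0 ?addr0 ?mulr0 //.
  apply: le_trans (sum_window_count_le _ gs) _; rewrite ler_peMr //= expr0 mul1r.
  apply: ler_wpDl; first by rewrite divr_ge0.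
  have := sL; rewrite /= -(ltr_nat R) => sL'.
  have k1 : 1 <= (size s).+1%:R :> R by rewrite ler1n.
  move: (_.+1%:R : R) sL' k1 => k kL k1.
  have h1 : 0 <= (k - 1) * (L%:R - k) by rewrite mulr_ge0 // subr_ge0 // ltW.
  have h2 : 0 <= (k - 1) * L%:R by rewrite mulr_ge0 // subr_ge0.
  lra.
set k := size (a1 :: s) in szs sL *.
have k0 : (0 < k)%N by [].
pose g t := \sum_(a <- a1 :: s) window_count n (a + t).
have gE1 : \sum_(a <- a1 :: s) window_count n.+1 a = \sum_w g (- v w).
  by rewrite /g [RHS]exchange_big; apply: eq_bigr => a _; rewrite window_countS.
have gE2 : \sum_(a <- a1 :: s) window_count n.+1 a = \sum_w g (v w).
  rewrite gE1 (reindex_inj (inv_inj invK)) /=.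
  by apply: eq_bigr => w _; rewrite v_inv opprK.
have g_bound t : g t <= #|W|%:R ^+ n * window_bound k n.
  rewrite /g -(big_map (fun a => a + t) predT) /=.
  have -> : k = size [seq a + t | a <- a1 :: s] by rewrite size_map.
  apply: IHn; first exact: (sorted_gap_shift t gs).
  by rewrite /= size_map.
have g_pair V : c <= V -> g (- V) + g V <=
    #|W|%:R ^+ n * (window_bound k.-1 n + window_bound k.+1 n).
  move=> cV; set s1 := [seq a - V | a <- s].
  set s2 := a1 - V :: [seq a + V | a <- a1 :: s].
  have -> : g (- V) + g V =
      \sum_(a <- s1) window_count n a + \sum_(a <- s2) window_count n a.
    by rewrite /g /s2 /s1 [in RHS]big_cons !big_map [X in X + _]big_cons; ring.
  have z1 : size s1 = k.-1 by rewrite size_map.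
  have z2 : size s2 = k.+1 by rewrite /= size_map.
  rewrite mulrDr -z1 -z2; apply: lerD; apply: IHn; rewrite ?z1 ?z2.
  - exact/sorted_gap_shift/(path_sorted gs).
  - lia.
  - have := sorted_gap_shift V gs; rewrite /= => ->; rewrite andbT /gap.
    by move: cV; lra.
  - by move: szs sL; lia.
(* When [|v w| >= c] the regrouping gains twice [lam ^+ n]; for the other w the induction bound for
   k windows is used twice. *)
have g_sym w : g (- v w) + g (v w) <=
    #|W|%:R ^+ n * (2 * window_bound k n - 2 * lam ^+ n * (c <= `|v w|)%R%:R).
  case: (boolP (c <= _)) => [cv|_] /=; last first.
    rewrite mulr0 subr0 mulrCA mulrDl mul1r; exact: lerD.
  have -> : g (- v w) + g (v w) = g (- `|v w|) + g `|v w|.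
    by case: (ler0P (v w)) => _; rewrite ?opprK // addrC.
  apply: le_trans (g_pair _ cv) _; rewrite ler_wpM2l // mulr1.
  rewrite /window_bound -(prednK k0) -!natr1 le_eqVlt; apply/orP; left; apply/eqP.
  rewrite /=; field.
  by rewrite gt_eqF.
have : 2 * \sum_(a <- a1 :: s) window_count n.+1 a <=
    \sum_w #|W|%:R ^+ n * (2 * window_bound k n - 2 * lam ^+ n * (c <= `|v w|)%R%:R).
  rewrite mulrDl mul1r {1}gE1 gE2 -big_split /=; exact: ler_sum.
rewrite -big_distrr /= sumrB sum_const -big_distrr /= => H.
have HW : rho * #|W|%:R <= \sum_w (c <= `|v w|)%R%:R.
  apply: le_trans v_large _; rewrite -sum1_card natr_sum big_mkcond /=.
  by apply: ler_sum => w _; rewrite inE; case: (c <= _).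
rewrite exprSr -mulrA -(ler_pM2l (ltr0n _ 2)).
apply: le_trans H _; rewrite [leRHS]mulrCA; apply: ler_wpM2l => //.
apply: (@le_trans _ _ (#|W|%:R * (2 * window_bound k n) - 2 * lam ^+ n * (rho * #|W|%:R))).
  by rewrite lerD2l lerN2 ler_wpM2l // mulr_ge0 // exprn_ge0.
have -> : #|W|%:R * (2 * window_bound k n) - 2 * lam ^+ n * (rho * #|W|%:R) =
   2 * (#|W|%:R * (window_bound k n - lam ^+ n * rho)) by ring.
rewrite !ler_wpM2l // /window_bound exprS.
set q : R := k%:R * (_ - _).
(* As k(2L - k) <= L^2, the average gain [lam ^+ n * rho] covers the loss incurred by replacing
   [lam ^+ n] with [lam ^+ n.+1]. *)
have qL : q * rho / L%:R ^+ 2 <= rho.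
  rewrite ler_pdivrMr ?exprn_gt0 // mulrC ler_wpM2l // /q.
  have := sqr_ge0 (L%:R - k%:R : R); nra.
have ln0 : 0 <= lam ^+ n by apply: exprn_ge0.
have := ler_wpM2l ln0 qL; rewrite /q.
have -> : lam * lam ^+ n * q = lam ^+ n * q - lam ^+ n * (q * rho / L%:R ^+ 2).
  by rewrite {1}/lam; ring.
rewrite /q; lra.
Qed.

(** The interval [-K, K] is covered by J consecutive windows of length 2c starting at -K. *)
Lemma card_small_sum_le (n J : nat) (K : R) :
  (J <= 2 * L)%N -> 2 * K < 2 * c * J%:R ->
  #|[set f : {ffun 'I_n -> W} | `|\sum_i v (f i)| <= K]|%:R <=
    #|W|%:R ^+ n * window_bound J n.
Proof.
move=> JL KJ; pose s := [seq - K + 2 * c * j%:R | j <- iota 0 J].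
have <- : size s = J by rewrite size_map size_iota.
apply: le_trans (sum_window_count_bound n _ _); last by rewrite size_map size_iota.
- rewrite /window_count exchange_big /= -sum1_card natr_sum big_mkcond /=.
  apply: ler_sum => f _; rewrite inE; case: ifP => [|_]; last exact: sumr_ge0.
  set x := \sum_i _; rewrite ler_norml => /andP[Kx xK].
  rewrite big_map.
  have c2 : 0 < 2 * c by rewrite mulr_gt0.
  have y0 : 0 <= (x + K) / (2 * c) by apply: divr_ge0; lra.
  pose j := Num.truncn ((x + K) / (2 * c)).
  have /andP[j1 j2] := truncn_itv y0; rewrite -/j in j1 j2.
  rewrite ler_pdivlMr // in j1; rewrite ltr_pdivrMr // in j2.
  have jJ : (j < J)%N by rewrite -(ltr_nat R) -(ltr_pM2l c2); lra.
  rewrite (bigD1_seq j) ?mem_iota ?iota_uniq //= ler_wpDr ?sumr_ge0 //.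
  rewrite /in_window; have -> : - K + 2 * c * j%:R <= x by lra.
  by have -> : x < - K + 2 * c * j%:R + 2 * c by rewrite -natr1 in j2; lra.
- rewrite sorted_map; apply: sub_sorted (iota_ltn_sorted 0 J) => i j /= ij.
  rewrite /gap /= -addrA lerD2l -[X in _ + X]mulr1 -mulrDr natr1.
  by rewrite ler_pM2l ?mulr_gt0 // ler_nat.
Qed.

End Anticoncentration.

Lemma expr_onemB_le (R : realFieldType) (x : R) n :
  0 <= x <= 1 -> (1 - x) ^+ n * (1 + n%:R * x) <= 1.
Proof.
move=> /andP[x0 x1]; elim: n => [|n IHn]; first by rewrite mul0r addr0 mulr1.
apply: le_trans IHn; rewrite exprSr -mulrA ler_wpM2l ?exprn_ge0 ?subr_ge0 //.
rewrite -natr1; have : 0 <= n%:R * x ^+ 2 by rewrite mulr_ge0 ?sqr_ge0.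
by have := sqr_ge0 x; lra.
Qed.

Lemma expr_onemB_eventually (R : archiRealFieldType) (x e : R) :
  0 < x <= 1 -> 0 < e -> exists n0, forall n, (n0 <= n)%N -> (1 - x) ^+ n <= e.
Proof.
move=> /andP[x0 x1] e0; exists (Num.bound (e^-1 / x)) => n nb.
have n1 : e^-1 / x <= n%:R.
  apply: ltW; apply: lt_le_trans (archi_boundP _) _.
    by rewrite divr_ge0 // ltW // invr_gt0.
  by rewrite ler_nat.
rewrite ler_pdivrMr // -[e^-1]div1r ler_pdivrMr // in n1.
have p0 : 0 <= (1 - x) ^+ n by rewrite exprn_ge0 // subr_ge0.
have : (1 - x) ^+ n * (1 + n%:R * x) <= 1 by apply: expr_onemB_le; rewrite ltW.
nra.
Qed.

(** The order of quantifiers matters: [n0] depends neither on [W] nor on [v], because the grid is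
    later chosen finer as the dimension grows. First L makes J/L at most d/2, then n makes the
    decaying term at most d/2. *)
Lemma small_sum_rare (R : archiRealFieldType) (c rho K d : R) :
  0 < c -> 0 < rho <= 1 -> 0 <= K -> 0 < d ->
  exists n0, forall (W : finType) (v : W -> R) (inv : W -> W),
    involutive inv -> (forall w, v (inv w) = - v w) ->
    rho * #|W|%:R <= #|[set w | c <= `|v w|]|%:R ->
    forall n, (n0 <= n)%N ->
    #|[set f : {ffun 'I_n -> W} | `|\sum_i v (f i)| <= K]|%:R <= d * #|W|%:R ^+ n.
Proof.
move=> c0 /andP[rho0 rho1] K0 d0.
pose J := (Num.bound (K / c)).+1.
have JK : 2 * K < 2 * c * J%:R.
  have : K / c < J%:R.
    apply: lt_le_trans (archi_boundP _) _; first by rewrite divr_ge0 // ltW.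
    by rewrite ler_nat.
  by rewrite ltr_pdivrMr // => ?; lra.
pose L := (J + Num.bound (2 * J%:R / d))%N.
have L0 : (0 < L)%N by [].
have JL : (J <= L)%N by rewrite leq_addr.
have dL : 2 * J%:R <= d * L%:R.
  rewrite [leRHS]mulrC -ler_pdivrMr //; apply: ltW.
  apply: lt_le_trans (archi_boundP _) _; first by rewrite divr_ge0 // ?mulr_ge0 // ltW.
  by rewrite ler_nat leq_addl.
have Lr : 1 <= L%:R :> R by rewrite ler1n.
have J1 : 1 <= J%:R :> R by rewrite ler1n.
have [||n0 n0P] := @expr_onemB_eventually R (rho / L%:R ^+ 2) (d / (4 * (J%:R * L%:R))).
- rewrite divr_gt0 ?exprn_gt0 ?ltr0n //= ler_pdivrMr ?exprn_gt0 ?ltr0n //.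
  by rewrite mul1r (le_trans rho1) // exprn_ege1.
- by rewrite divr_gt0 // !mulr_gt0 // ltr0n.
exists n0 => W v inv invK v_inv vl n /n0P ln.
have r01 : 0 <= rho <= 1 by rewrite ltW.
apply: le_trans (card_small_sum_le invK v_inv c0 r01 vl L0 _ _ JK) _.
  by rewrite (leq_trans JL) // leq_pmull.
rewrite mulrC ler_wpM2r ?exprn_ge0 // /window_bound.
have h1 : J%:R / L%:R <= d / 2.
  by rewrite ler_pdivrMr ?ltr0n //; lra.
move: ln; set q := _ ^+ n; rewrite ler_pdivlMr ?mulr_gt0 ?ltr0n // => ln.
have q0 : 0 <= q.
  rewrite exprn_ge0 // subr_ge0 ler_pdivrMr ?exprn_gt0 ?ltr0n //.
  by rewrite mul1r (le_trans rho1) // exprn_ege1.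
have h2 : q * (J%:R * J%:R) >= 0 by rewrite !mulr_ge0.
lra.
Qed.

(** * The generalized Bollobás–Erdős graph *)

(** For an irreflexive relation the second condition makes [f] injective. *)
Definition clique_in (V : finType) (e : rel V) (S : {set V}) (k : nat) : Prop :=
  exists f : 'I_k -> V,
    (forall i, f i \in S) /\ (forall i j, i != j -> e (f i) (f j)).

Section Construction.
Variables (R : archiRealFieldType) (u d m M t l : nat) (K : R).
Hypothesis m0 : (0 < m)%N.

(** The midpoints of m equal cells of [-1, 1], so that [rev_ord] acts as negation. *)
Definition height (i : 'I_m) : R := (2 * i%:R + 1 - m%:R) / m%:R.

Lemma height_rev i : height (rev_ord i) = - height i.
Proof.
have iE : (rev_ord i)%:R + i%:R + 1 = m%:R :> R.
  rewrite -natrD natr1 /=; congr (_%:R); have := ltn_ord i; lia.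
by rewrite /height -mulNr; congr (_ / _); move: iE; lra.
Qed.

Lemma height_dist i j : (height i - height j) ^+ 2 = 4 * ((i%:R - j%:R) ^+ 2 / m%:R ^+ 2).
Proof. by rewrite /height; field; rewrite pnatr_eq0 -lt0n. Qed.

Hypothesis K0 : 0 <= K.
Hypothesis t0 : (0 < t)%N.

Definition grid := {ffun 'I_d -> 'I_m}.

Definition inner (x y : grid) : R := \sum_j height (x j) * height (y j).

Definition sqnormD (x y : grid) : R := \sum_j (height (x j) + height (y j)) ^+ 2.

Definition block := ({ffun 'I_u * 'I_u -> grid} * {ffun 'I_M -> 'I_t})%type.

Definition agree (y y' : block) : nat := #|[set i | y.2 i == y'.2 i]|.

Definition part_adj : rel block := fun y y' =>
  (t.+1 ^ 2 * agree y y' < M)%N &&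
  [exists p, forall q, sqnormD (y.1 (p, q)) (y'.1 (p, q)) <= K].

(* The index (p, q) is transposed on one side to make the relation symmetric. *)
Definition cross_adj : rel block := fun y y' =>
  [forall p, forall q, K < inner (y.1 (p, q)) (y'.1 (q, p))].

Definition be_adj : rel ('I_l * block) := fun v w =>
  if v.1 == w.1 then part_adj v.2 w.2 else cross_adj v.2 w.2.

Lemma innerC x y : inner x y = inner y x.
Proof. by apply: eq_bigr => j _; rewrite mulrC. Qed.

Lemma part_adj_sym : symmetric part_adj.
Proof.
move=> y y'; rewrite /part_adj /agree.
under eq_finset do rewrite eq_sym.
congr (_ && _); apply: eq_existsb => p; apply: eq_forallb => q.
by congr (_ <= _); apply: eq_bigr => j _; rewrite addrC.
Qed.

Lemma part_adj_irr : irreflexive part_adj.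
Proof.
move=> y; rewrite /part_adj /agree.
have -> : [set i | y.2 i == y.2 i] = setT by apply/setP => i; rewrite !inE eqxx.
by rewrite cardsT card_ord ltnNge leq_pmull ?expn_gt0.
Qed.

Lemma cross_adj_sym : symmetric cross_adj.
Proof.
have H y y' : cross_adj y y' -> cross_adj y' y.
  move=> /forallP h; apply/forallP => p; apply/forallP => q.
  by rewrite innerC; have /forallP := h q; apply.
by move=> y y'; apply/idP/idP; apply: H.
Qed.

Lemma be_adj_sym : symmetric be_adj.
Proof. by move=> v w; rewrite /be_adj eq_sym part_adj_sym cross_adj_sym. Qed.

Lemma be_adj_irr : irreflexive be_adj.
Proof. by move=> v; rewrite /be_adj eqxx part_adj_irr. Qed.

(** Among t + 1 words over t letters, two share a letter at each of the M positions. But each of the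
    (t + 1)^2 ordered pairs agrees in fewer than M/(t + 1)^2 positions. *)
Lemma part_clique_size (I : finType) (f : I -> block) (C : {set I}) :
  {in C &, forall a b, a != b -> part_adj (f a) (f b)} -> (#|C| <= t)%N.
Proof.
move=> fC; rewrite leqNgt; apply/negP => tC.
pose g (a : 'I_t.+1) : I := enum_val (widen_ord tC a).
have gI : injective g by move=> a b /enum_val_inj [] ab; apply: val_inj.
have gC a : g a \in C by apply: enum_valP.
pose F (a b : 'I_t.+1) := (if a != b then agree (f (g a)) (f (g b)) else 0)%N.
have gE a b : a != b -> part_adj (f (g a)) (f (g b)).
  by move=> ab; apply: fC; rewrite ?gC // (inj_eq gI).
(* The weak bound with [M.-1] also holds on the diagonal, where [F] is 0, and keeps the strictness
   under summation. *)
have FM a b : (t.+1 ^ 2 * F a b <= M.-1)%N.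
  rewrite /F; case: ifP => [/gE/andP[+ _]|_]; last by rewrite muln0.
  by case: M.
have M_gt0 : (0 < M)%N.
  have /gE/andP[+ _] : (ord0 : 'I_t.+1) != ord_max by rewrite -val_eqE /=; case: (t) t0.
  by apply: leq_ltn_trans.
have MF : (M <= \sum_a \sum_b F a b)%N.
  have -> : (\sum_a \sum_b F a b =
     \sum_(i < M) \sum_a \sum_b (a != b) && ((f (g a)).2 i == (f (g b)).2 i))%N.
    rewrite [RHS]exchange_big; apply: eq_bigr => a _ /=.
    rewrite [RHS]exchange_big; apply: eq_bigr => b _ /=.
    rewrite /F /agree; case: (a != b) => /=; last by rewrite big1.
    by rewrite -sum1_card big_mkcond; apply: eq_bigr => i _; rewrite inE; case: eqP.
  rewrite -[leqLHS]card_ord -sum1_card; apply: leq_sum => i _.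
  have /injectivePn[a [b ab eq_ab]] : ~~ injectiveb (fun a => (f (g a)).2 i).
    by apply/injectiveP => /leq_card; rewrite !card_ord ltnn.
  by rewrite (bigD1 a) //= (bigD1 b) //= ab eq_ab eqxx.
have : (t.+1 ^ 2 * \sum_a \sum_b F a b <= t.+1 ^ 2 * M.-1)%N.
  have -> : (t.+1 ^ 2 * M.-1 = \sum_(a < t.+1) \sum_(b < t.+1) M.-1)%N.
    by rewrite !sum_nat_const !card_ord mulnA.
  rewrite big_distrr; apply: leq_sum => a _ /=.
  by rewrite big_distrr; apply: leq_sum => b _ /=.
rewrite leq_pmul2l ?expn_gt0 // => /(leq_trans MF); case: (M) M_gt0 => //= n _.
by rewrite ltnn.
Qed.

(** One pair controls its row p in every column, the other its row q. So the entries (p, q) and (q,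
    p), which [cross_adj] matches, are both controlled. *)
Lemma no_two_double_parts y1 y2 w1 w2 : part_adj y1 y2 -> part_adj w1 w2 ->
  cross_adj y1 w1 -> cross_adj y1 w2 -> cross_adj y2 w1 -> cross_adj y2 w2 -> False.
Proof.
move=> /andP[_ /existsP[p /forallP /= hy]] /andP[_ /existsP[q /forallP /= hw]].
move=> /forallP/(_ p)/forallP/(_ q) h11 /forallP/(_ p)/forallP/(_ q) h12.
move=> /forallP/(_ p)/forallP/(_ q) h21 /forallP/(_ p)/forallP/(_ q) h22.
have {}hy := hy q; have {}hw := hw p.
suff : 2 * (inner (y1.1 (p, q)) (w1.1 (q, p)) + inner (y1.1 (p, q)) (w2.1 (q, p))
    + inner (y2.1 (p, q)) (w1.1 (q, p)) + inner (y2.1 (p, q)) (w2.1 (q, p))) <=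
    sqnormD (y1.1 (p, q)) (y2.1 (p, q)) + sqnormD (w1.1 (q, p)) (w2.1 (q, p)).
  by move: K0; lra.
rewrite /inner /sqnormD -!big_split big_distrr /=; apply: ler_sum => j _.
set a := height _; set b := height _; set a' := height (y2.1 _ _); set b' := height (w2.1 _ _).
have := sqr_ge0 (a + a' - b - b'); lra.
Qed.

(** At most one part holds two or more vertices of a clique, and it holds at most t, so a clique has
    at most t + (l - 1) vertices. *)
Lemma be_adj_clique_free : (2 <= t)%N -> ~ clique_in be_adj setT (t + l).
Proof.
move=> t2 [f [_ fE]].
pose C i := [set a | (f a).1 == i].
have sumC : (\sum_i #|C i| = t + l)%N.
  rewrite -[RHS]card_ord -sum1_card (partition_big (fun a => (f a).1) predT) //=.
  by apply: eq_bigr => i _; rewrite -sum1_card; apply: eq_bigl => a; rewrite inE.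
have Ct i : (#|C i| <= t)%N.
  apply: (@part_clique_size _ (fun a => (f a).2)) => a b.
  rewrite !inE => /eqP ai /eqP bi ab.
  by have := fE _ _ ab; rewrite /be_adj ai bi eqxx.
case: (pickP (fun i => 1 < #|C i|)%N) => [i0 i02|small]; last first.
  have : (\sum_i #|C i| <= \sum_(i < l) 1)%N.
    by apply: leq_sum => i _; rewrite leqNgt small.
  by rewrite sumC sum1_card card_ord; lia.
have small i : i != i0 -> (#|C i| <= 1)%N.
  move=> ii0; rewrite leqNgt; apply/negP.
  move: i02 => /card_gt1P[a1 [a2 [+ + a12]]] /card_gt1P[b1 [b2 [+ + b12]]].
  rewrite !inE => /eqP a1i /eqP a2i /eqP b1i /eqP b2i.
  have cr a b : (f a).1 = i0 -> (f b).1 = i -> cross_adj (f a).2 (f b).2.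
    move=> ai bi; have ab : a != b.
      by apply: contra_neq ii0 => ab; rewrite -ai -bi ab.
    by have := fE _ _ ab; rewrite /be_adj ai bi eq_sym (negbTE ii0).
  have := fE _ _ a12; have := fE _ _ b12.
  rewrite /be_adj a1i a2i b1i b2i !eqxx => hb ha.
  by apply: (no_two_double_parts ha hb); apply: cr.
have : (\sum_i #|C i| <= t + \sum_(i < l | i != i0) 1)%N.
  by rewrite (bigD1 i0) //= leq_add // leq_sum.
have -> : (\sum_(i < l | i != i0) 1 = l.-1)%N.
  by rewrite sum1_card -[X in X.-1]card_ord -(cardC1 i0); apply: eq_card.
by have := ltn_ord i0; rewrite sumC; lia.
Qed.

(** A quarter of the squared Euclidean distance, by [height_dist], plus a Hamming distance weighted
    by [k]. *)
Definition block_cost (k : R) (y y' : block) : R :=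
  (\sum_s \sum_j ((y.1 s j)%:R - (y'.1 s j)%:R) ^+ 2 / m%:R ^+ 2) +
  \sum_i k * (y.2 i != y'.2 i)%:R.

Lemma block_cost_ge0 k y y' : 0 <= k -> 0 <= block_cost k y y'.
Proof.
move=> k0; apply: addr_ge0; last by apply: sumr_ge0 => i _; apply: mulr_ge0.
apply: sumr_ge0 => s _; apply: sumr_ge0 => j _.
by rewrite divr_ge0 ?sqr_ge0.
Qed.

Lemma block_cost_xx k y : block_cost k y y = 0.
Proof.
rewrite /block_cost big1 ?add0r => [|s _].
  by apply: big1 => i _; rewrite eqxx mulr0.
by apply: big1 => j _; rewrite subrr expr0n mul0r.
Qed.

Lemma poincare_block k : 0 <= k ->
  poincare (block_cost k) 16
    ((u * u * d)%:R * (4 / m%:R ^+ 2) + M%:R * k ^+ 2).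
Proof.
move=> k0.
pose cg (i j : 'I_m) : R := (i%:R - j%:R) ^+ 2 / m%:R ^+ 2.
pose ch (a b : 'I_t) : R := k * (a != b)%:R.
have Pg := @poincare_ffun R ('I_u * 'I_u)%type _ _ _ _
  (@poincare_ffun R 'I_d _ _ _ _ (@poincare_grid R m)).
have Ph : poincare (fun z z' : {ffun 'I_M -> 'I_t} => \sum_i ch (z i) (z' i))
    16 (M%:R * k ^+ 2).
  rewrite -[M in M%:R * _]card_ord; apply: poincare_ffun.
  (* The factor 0 is raised to 16, since [poincare_prod] asks for a common one. *)
  apply: (@poincare_weaken R _ ch 0 (k ^+ 2)) => // [x y|]; first exact: mulr_ge0.
  exact: poincare_hamming.
by move: (poincare_prod Pg Ph); rewrite mulrA -natrM card_prod !card_ord.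
Qed.

End Construction.

(** * Cliques in dense subsets of a part *)

Section Independence.
Variables (R : archiRealFieldType) (u d m M t' l : nat) (K : R).
Hypothesis m0 : (0 < m)%N.
Local Notation t := t'.+1.
Local Notation block := (block u d m M t).
Variable sgn : 'I_t -> 'I_u -> bool.
Hypothesis sgn_inj : forall a b, a != b -> exists p, sgn a p != sgn b p.

(** Since [t] is a successor, ['I_t] is a cyclic group and subtraction of [a] a cyclic shift of the
    alphabet. *)
Definition twist (a : 'I_t) (y : block) : block :=
  ([ffun s => [ffun j => if sgn a s.1 then rev_ord (y.1 s j) else y.1 s j]],
   [ffun i => y.2 i - a]).

Lemma twist_inj a : injective (twist a).
Proof.
move=> [x z] [x' z'] [] /ffunP hx /ffunP hz; congr (_, _); apply/ffunP => i.
  apply/ffunP => j; have := hx i; rewrite !ffunE => /ffunP/(_ j); rewrite !ffunE /=.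
  by case: (sgn _ _) => // /rev_ord_inj.
by have := hz i; rewrite !ffunE /= => /addIr.
Qed.

(** Where the words of [ya] and [yb] agree, distinct shifts cannot both match [y0], so each
    agreement costs at least [k]. In a row where the signs differ, one of the two points is near
    that of [y0] and the other near its negative, so their sum is short. *)
Lemma twist_part_adj (k r : R) (a b : 'I_t) (y0 ya yb : block) :
  0 < k -> (t.+1 ^ 2)%:R * (2 * r) < k * M%:R -> 16 * r <= K ->
  a != b ->
  block_cost k y0 (twist a ya) <= r -> block_cost k y0 (twist b yb) <= r ->
  part_adj K ya yb.
Proof.
move=> k0 rM rK ab ca cb; apply/andP; split.
  pose h a y := \sum_i k * (y0.2 i != (twist a y).2 i)%:R.
  have hr a' y : block_cost k y0 (twist a' y) <= r -> h a' y <= r.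
    apply: le_trans; rewrite lerDr; apply: sumr_ge0 => s _; apply: sumr_ge0 => j _.
    by rewrite divr_ge0 ?sqr_ge0.
  have : k * (agree ya yb)%:R <= h a ya + h b yb.
    rewrite -big_split /agree -sum1_card natr_sum big_distrr big_mkcond /=.
    apply: ler_sum => i _; rewrite inE !ffunE; case: ifP => [/eqP e|_].
      have : (y0.2 i != ya.2 i - a) || (y0.2 i != yb.2 i - b).
        rewrite -negb_and; apply: contra ab => /andP[/eqP-> /eqP].
        by rewrite e => /addrI/oppr_inj->.
      by case: (_ != _); case: (_ != _) => //= _; lra.
    by rewrite addr_ge0 // mulr_ge0 // ltW.
  have := hr _ _ ca; have := hr _ _ cb => h1 h2 h3.
  rewrite -(ltr_nat R) natrM -(ltr_pM2l k0); apply: le_lt_trans rM.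
  rewrite mulrCA ler_wpM2l //; lra.
have [p sp] := sgn_inj ab; apply/existsP; exists p; apply/forallP => q.
apply: le_trans rK.
pose h a y := \sum_j ((y0.1 (p, q) j)%:R - ((twist a y).1 (p, q) j)%:R) ^+ 2 / m%:R ^+ 2 : R.
have hr a' y : block_cost k y0 (twist a' y) <= r -> h a' y <= r.
  apply: le_trans; rewrite /block_cost (bigD1 (p, q)) //= -addrA lerDl.
  apply: addr_ge0; last by apply: sumr_ge0 => i _; rewrite mulr_ge0 // ltW.
  apply: sumr_ge0 => s _; apply: sumr_ge0 => j _.
  by rewrite divr_ge0 ?sqr_ge0.
(* The factor 8 is 4 from [height_dist] times 2 from (a + b)^2 <= 2a^2 + 2b^2. *)
apply: (@le_trans _ _ (8 * (h a ya + h b yb))); last first.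
  by have := hr _ _ ca; have := hr _ _ cb; lra.
rewrite -big_split big_distrr; apply: ler_sum => j _ /=.
have -> (x y : R) : 8 * (x + y) = 2 * (4 * x + 4 * y) by ring.
rewrite -!(@height_dist R m m0) !ffunE /=.
move: sp; case: (sgn a p); case: (sgn b p) => //= _; rewrite height_rev //.
  have := sqr_ge0 ((height R (y0.1 (p, q) j) + height R (ya.1 (p, q) j)) +
    (height R (y0.1 (p, q) j) - height R (yb.1 (p, q) j))).
  nra.
have := sqr_ge0 ((height R (y0.1 (p, q) j) - height R (ya.1 (p, q) j)) +
    (height R (y0.1 (p, q) j) + height R (yb.1 (p, q) j))).
nra.
Qed.

(** Twists are injective, so all t images of [A] have density at least e, and the points farther
    than r from a given image form less than 1/t of the space. Some [y0] is thus close to all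
    images, and the points of [A] whose images are near it form the clique. *)
Lemma dense_clique (k r e : R) (A : {set block}) :
  0 < k -> (t.+1 ^ 2)%:R * (2 * r) < k * M%:R -> 16 * r <= K ->
  0 < e -> 0 <= r ->
  t%:R * (64 / e + ((u * u * d)%:R * (4 / m%:R ^+ 2) + M%:R * k ^+ 2)) < r ^+ 2 * e ->
  A != set0 -> e * #|{: block}|%:R <= #|A|%:R ->
  clique_in (part_adj K) A t.
Proof.
set k2 := (_ + M%:R * _) => k0 rM rK e0 r0 re A0 eA.
pose B a := [set x | [forall (y | y \in twist a @: A), r < block_cost k x y]].
have Bsmall a : #|B a|%:R * t%:R < #|{: block}|%:R :> R.
  have X0 : 0 < #|{: block}|%:R :> R.
    by rewrite ltr0n; have /set0Pn[x _] := A0; apply/card_gt0P; exists x.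
  have H : #|B a|%:R * (r ^+ 2 * e) <= #|{: block}|%:R * (16 ^+ 2 / (4 * e) + k2).
    apply: (poincare_concentration (poincare_block (ltW k0))) => //.
    - by move=> x y; apply/block_cost_ge0/ltW.
    - exact: block_cost_xx.
    - by have /set0Pn[x xA] := A0; apply/set0Pn; exists (twist a x); apply: imset_f.
    - by rewrite card_imset //; apply: twist_inj.
  have E : 16 ^+ 2 / (4 * e) = 64 / e by field; rewrite gt_eqF.
  have k20 : 0 <= k2.
    by apply: addr_ge0; rewrite mulr_ge0 ?sqr_ge0 // divr_ge0 // sqr_ge0.
  rewrite E in H; have re0 : 0 < r ^+ 2 * e.
    apply: le_lt_trans re; apply: mulr_ge0 => //; apply: addr_ge0 => //.
    by rewrite divr_ge0 // ltW.
  rewrite -(ltr_pM2r re0); apply: le_lt_trans (_ : _ <= #|{: block}|%:R * (t%:R * (64 / e + k2))) _.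
    by rewrite mulrAC [leRHS]mulrCA mulrC ler_wpM2l.
  by rewrite ltr_pM2l.
have [y0 y0P] : exists y0, y0 \notin \bigcup_a B a.
  apply/existsP; rewrite -negb_forall; apply/negP => /forallP all.
  have cover : (#|{: block}| <= \sum_a #|B a|)%N.
    under eq_bigr do rewrite -sum1_card big_mkcond.
    rewrite exchange_big -sum1_card; apply: leq_sum => x _.
    by have /bigcupP[a _ xa] := all x; rewrite (bigD1 a) //= xa.
  have : (\sum_a #|B a|)%:R * t%:R < \sum_(a < t) #|{: block}|%:R :> R.
    rewrite natr_sum big_distrl; apply: ltr_sum => [|a _]; last exact: Bsmall.
    by apply/hasP; exists ord0; rewrite // mem_index_enum.
  by rewrite sum_const card_ord mulrC ltr_pM2l ?ltr0n // ltr_nat ltnNge cover.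
have yP a : exists y, (y \in A) && (block_cost k y0 (twist a y) <= r).
  apply/existsP; move: y0P; apply: contraR => /existsPn H.
  apply/bigcupP; exists a => //.
  rewrite inE; apply/forall_inP => _ /imsetP[y yA ->].
  by have := H y; rewrite yA /= -ltNge.
have [f fP] := fin_all_exists yP.
exists f; split=> [a|a b ab]; first by have /andP[] := fP a.
have /andP[_ ca] := fP a; have /andP[_ cb] := fP b.
exact: twist_part_adj k0 rM rK ab ca cb.
Qed.

End Independence.

Lemma sum_in_le_partition (R : realFieldType) (I V : finType) (e : R) (S : {set I * V}) :
  (0 < #|I|)%N -> e * #|{: I * V}|%:R <= #|S|%:R ->
  exists i, e * #|V|%:R <= #|[set v | (i, v) \in S]|%:R.
Proof.
move=> I0 eS; apply/existsP; rewrite -[X in is_true X]negbK negb_exists; apply/negP => /forallP H.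
have cS : #|S|%:R = \sum_i #|[set v | (i, v) \in S]|%:R :> R.
  rewrite -natr_sum; congr (_%:R); rewrite -sum1_card.
  rewrite (partition_big fst predT) //=; apply: eq_bigr => i _.
  rewrite -sum1_card (reindex_onto (pair i) snd) /=.
    by apply: eq_bigl => v; rewrite inE !eqxx !andbT.
  by case=> [j v] /andP[_ /eqP /= ->].
have : #|S|%:R < \sum_(i : I) e * #|V|%:R.
  rewrite cS; apply: ltr_sum => [|i _]; last by rewrite ltNge.
  by have /card_gt0P[i _] := I0; apply/hasP; exists i; rewrite // mem_index_enum.
by rewrite sum_const mulrCA -natrM -card_prod ltNge eS.
Qed.

(** * Edge density between two parts *)

Section Density.
Variables (R : archiRealFieldType) (u d m M t l : nat) (K : R).
Hypothesis m0 : (0 < m)%N.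
Local Notation block := (block u d m M t).

Definition cross_pairs : {set grid d m * grid d m} := [set p | K < inner R p.1 p.2].

(** The u^2 conditions involve disjoint pairs of coordinates, hence are independent; the words are
    unconstrained. *)
Lemma card_cross :
  #|[set p : block * block | cross_adj K p.1 p.2]| =
  (#|{: {ffun 'I_M -> 'I_t}}| ^ 2 * #|cross_pairs| ^ (u ^ 2))%N.
Proof.
pose b (x y : grid d m) : nat := K < inner R x y.
pose sw (s : 'I_u * 'I_u) := (s.2, s.1).
have swK : involutive sw by case.
have cE (y y' : block) : (cross_adj K y y' : nat) = (\prod_s b (y.1 s) (y'.1 (sw s)))%N.
  rewrite /b; case: (boolP (cross_adj _ _ _)) => [/forallP h|].
    by rewrite big1 // => -[p q] _; have /forallP/(_ q) -> := h p.
  rewrite negb_forall => /existsP[p]; rewrite negb_forall => /existsP[q /negbTE h].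
  by rewrite (bigD1 (p, q)) //= h.
pose X := {ffun 'I_u * 'I_u -> grid d m}.
rewrite -sum1_card big_mkcond /=.
under eq_bigr => p _ do rewrite inE -[if _ then _ else _]/(nat_of_bool _) cE.
rewrite -(pair_bigA _ (fun y y' : block => \prod_s b (y.1 s) (y'.1 (sw s))))%N /=.
have pairE (A B : finType) (F : A * B -> nat) : (\sum_p F p = \sum_x \sum_y F (x, y))%N.
  by rewrite pair_bigA; apply: eq_bigr => -[].
rewrite pairE.
have inner_sum (x : X) : (\sum_(y' : block) \prod_s b (x s) (y'.1 (sw s)) =
    #|{: {ffun 'I_M -> 'I_t}}| * \prod_s \sum_w b (x s) w)%N.
  rewrite pairE exchange_big -sum_nat_const; apply: eq_bigr => z _ /=.
  rewrite bigA_distr_bigA /=.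
  rewrite (reindex (fun x' : X => [ffun s => x' (sw s)])) /=; last first.
    apply: onW_bij; exists (fun x' : X => [ffun s => x' (sw s)]) => x';
      by apply/ffunP => s; rewrite !ffunE swK.
  by apply: eq_bigr => x' _; apply: eq_bigr => s _; rewrite ffunE swK.
under eq_bigr => x _ do under eq_bigr => z _ do rewrite /= inner_sum.
under eq_bigr do rewrite sum_nat_const.
rewrite -!big_distrr /= mulnA mulnn; congr (_ * _)%N.
rewrite -(bigA_distr_bigA (fun (s : 'I_u * 'I_u) x => \sum_w b x w)%N) /=.
rewrite prod_nat_const card_prod !card_ord -mulnn; congr (_ ^ _)%N.
rewrite -sum1_card pair_bigA [RHS]big_mkcond /=; apply: eq_bigr => -[x y] _.
by rewrite inE /b; case: (K < _).
Qed.

(** Negating the first point shows that values above K and below -K are equally frequent, and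
    together they make up a proportion of at least 1 - e. *)
Lemma card_cross_pairs_ge (e : R) : 0 <= K ->
  #|[set p : grid d m * grid d m | `|inner R p.1 p.2| <= K]|%:R <= e * #|{: grid d m}|%:R ^+ 2 ->
  (1 - e) / 2 * #|{: grid d m}|%:R ^+ 2 <= #|cross_pairs|%:R.
Proof.
move=> K0 small.
pose fl (p : grid d m * grid d m) : grid d m * grid d m := ([ffun j => rev_ord (p.1 j)], p.2).
have flI : injective fl.
  move=> [x y] [x' y'] [] /ffunP h ->; congr (_, _); apply/ffunP => j.
  by have := h j; rewrite !ffunE => /rev_ord_inj.
have innerN p : inner R (fl p).1 (fl p).2 = - inner R p.1 p.2.
  rewrite /inner -sumrN; apply: eq_bigr => j _.
  by rewrite ffunE height_rev // mulNr.
pose N := [set p : grid d m * grid d m | inner R p.1 p.2 < - K].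
have cN : #|N| = #|cross_pairs|.
  apply/eqP; rewrite eqn_leq; apply/andP; split.
    rewrite -(card_imset N flI).
    apply/subset_leq_card/subsetP => _ /imsetP[p + ->].
    by rewrite !inE innerN ltrNr.
  rewrite -(card_imset cross_pairs flI).
  apply/subset_leq_card/subsetP => _ /imsetP[p + ->].
  by rewrite !inE innerN ltrN2.
pose Z := [set p : grid d m * grid d m | `|inner R p.1 p.2| <= K].
have cover : (#|{: grid d m}| ^ 2 <= #|N| + #|cross_pairs| + #|Z|)%N.
  rewrite -mulnn -card_prod -cardsT.
  apply: (@leq_trans #|(N :|: cross_pairs) :|: Z|).
    apply/subset_leq_card/subsetP => p _; rewrite !inE.
    case: (ltrP (inner R p.1 p.2) (- K)) => //= h1.
    case: (ltrP K (inner R p.1 p.2)) => //= h2.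
    by rewrite ler_norml h1 h2.
  apply: leq_trans (leq_card_setU _ _) _; rewrite leq_add2r.
  exact: leq_card_setU.
have : #|{: grid d m}|%:R ^+ 2 <= #|cross_pairs|%:R + #|cross_pairs|%:R + #|Z|%:R :> R.
  by rewrite -natrX -!natrD ler_nat -{1}cN.
move: small; rewrite -/Z; lra.
Qed.

End Density.

Lemma small_inner_rare (R : archiRealFieldType) (K e : R) : 0 <= K -> 0 < e ->
  exists d0, forall d m, (d0 <= d)%N -> (0 < m)%N ->
    #|[set p : grid d (4 * m) * grid d (4 * m) | `|inner R p.1 p.2| <= K]|%:R <=
      e * #|{: grid d (4 * m)}|%:R ^+ 2.
Proof.
move=> K0 e0.
(* In a grid of 4m points the m lowest have height at most -1/2, so at least 1/16 of the pairs have
   a product of absolute value at least 1/4. *)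
have [||d0 d0P] := @small_sum_rare R 4^-1 16^-1 K e _ _ K0 e0; try lra.
exists d0 => d m dd0 m0.
have m40 : (0 < 4 * m)%N by rewrite muln_gt0.
pose v (w : 'I_(4 * m) * 'I_(4 * m)) := height R w.1 * height R w.2.
pose inv (w : 'I_(4 * m) * 'I_(4 * m)) := (rev_ord w.1, w.2).
have cardE : #|{: 'I_(4 * m) * 'I_(4 * m)}|%:R ^+ d = #|{: grid d (4 * m)}|%:R ^+ 2 :> R.
  by rewrite card_prod card_ffun !card_ord natrM natrX -expr2 -!exprM [(2 * d)%N]mulnC.
pose S := [set f : {ffun 'I_d -> 'I_(4 * m) * 'I_(4 * m)} | `|\sum_i v (f i)| <= K].
have -> : #|[set p : grid d (4 * m) * grid d (4 * m) | `|inner R p.1 p.2| <= K]| = #|S|.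
  pose h (f : {ffun 'I_d -> 'I_(4 * m) * 'I_(4 * m)}) : grid d (4 * m) * grid d (4 * m) :=
    ([ffun j => (f j).1], [ffun j => (f j).2]).
  have hI : injective h.
    move=> f g [] /ffunP h1 /ffunP h2; apply/ffunP => j.
    by move: (h1 j) (h2 j); rewrite !ffunE; case: (f j) (g j) => ? ? [? ?] /= -> ->.
  have innerE f : inner R (h f).1 (h f).2 = \sum_i v (f i).
    by apply: eq_bigr => j _; rewrite !ffunE.
  rewrite -(card_imset S hI); apply: eq_card => -[x y].
  apply/idP/imsetP => [|[f fS ->]]; last by move: fS; rewrite !inE innerE.
  rewrite inE => xy; have hE : (x, y) = h [ffun j => (x j, y j)].
    by congr (_, _); apply/ffunP => j; rewrite !ffunE.
  by exists [ffun j => (x j, y j)] => //; rewrite inE -innerE -hE.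
rewrite -cardE; apply: (d0P _ v inv) dd0.
- by case=> i j; rewrite /inv /= rev_ordK.
- by case=> i j; rewrite /v /inv /= height_rev // mulNr.
have m4 : (m <= 4 * m)%N by rewrite leq_pmull.
pose w (p : 'I_m * 'I_m) : 'I_(4 * m) * 'I_(4 * m) :=
  (widen_ord m4 p.1, widen_ord m4 p.2).
have wI : injective w.
  by move=> [i j] [i' j'] [] ei ej; congr (_, _); apply: val_inj.
apply: (@le_trans _ _ #|w @: setT|%:R).
  rewrite card_imset // cardsT !card_prod !card_ord !natrM; lra.
rewrite ler_nat; apply/subset_leq_card/subsetP => _ /imsetP[p _ ->].
rewrite inE /v normrM.
have H (i : 'I_m) : 2^-1 <= `|height R (widen_ord m4 i : 'I_(4 * m))|.
  have im : i.+1%:R <= m%:R :> R by rewrite ler_nat.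
  rewrite -normrN; apply: le_trans (ler_norm _).
  rewrite /height -mulNr ler_pdivlMr ?ltr0n //= natrM.
  by rewrite -natr1 in im; lra.
have := ler_pM _ _ (H p.1) (H p.2); rewrite invr_ge0 ler0n => /(_ isT isT).
by apply: le_trans; lra.
Qed.

Lemma density_arith (R : realFieldType) (l X Z B n : nat) (q : R) :
  (0 < l)%N -> 0 <= q -> q * X%:R ^+ 2 <= B%:R ->
  (1 - l%:R^-1) * q ^+ n * (l * (X ^ n * Z))%:R ^+ 2 <=
    (l * l.-1 * (Z ^ 2 * B ^ n))%:R.
Proof.
move=> l0 q0 qX.
have qn : q ^+ n * (X%:R ^+ n) ^+ 2 <= B%:R ^+ n.
  rewrite exprAC -exprMn; apply: lerXn2r; rewrite ?nnegrE //.
  by rewrite mulr_ge0 ?sqr_ge0.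
have lR : (l.-1)%:R = l%:R - 1 :> R by rewrite -subn1 natrB.
have l1 : l%:R != 0 :> R by rewrite pnatr_eq0 -lt0n.
have := ler_wpM2l (ler0n R (l * l.-1 * Z ^ 2)) qn.
rewrite !natrM !natrX lR; congr (_ <= _); last by ring.
by field.
Qed.

(** The parameters are fixed in the order r, K, M, dimension, grid size: the radius must not depend
    on the dimension, which is chosen large in terms of K. *)
Lemma bollobas_erdos_graph (R : archiRealFieldType) (t l : nat) (e d : R) :
  (2 <= t)%N -> (2 <= l)%N -> 0 < e -> 0 < d < 1 ->
  exists (V : finType) (E : rel V),
    [/\ symmetric E, irreflexive E, (0 < #|V|)%N, ~ clique_in E setT (t + l) &
        (forall S : {set V}, e * #|V|%:R <= #|S|%:R -> clique_in E S t) /\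
        (1 - l%:R^-1) * ((1 - d) / 2) ^+ (uphalf t ^ 2) * #|V|%:R ^+ 2
          <= #|[set p : V * V | E p.1 p.2]|%:R].
Proof.
move=> t2 l2 e0 /andP[d0 d1].
case: t t2 => // t' t2; set t := t'.+1 in t2 *.
pose u := uphalf t.
have u0 : (0 < u)%N by rewrite /u; lia.
have [sgn sgnP] : exists sgn : 'I_t -> 'I_u -> bool,
    forall a b, a != b -> exists p, sgn a p != sgn b p.
  have tc : (t <= #|{: {ffun 'I_u -> bool}}|)%N.
    rewrite card_ffun card_bool card_ord.
    (* Here t <= 2u <= 2^u, so there are enough sign vectors. *)
    apply: (@leq_trans (2 * u)); first by rewrite /u; lia.
    by case: (u) u0 => // n _; rewrite expnS leq_pmul2l // ltn_expl.
  pose g (a : 'I_t) : {ffun 'I_u -> bool} := enum_val (widen_ord tc a).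
  exists g => a b ab; apply/existsP; move: ab; apply: contraR => /existsPn H.
  apply/eqP/val_inj; suff /enum_val_inj [] : g a = g b by [].
  by apply/ffunP => p; have := H p; rewrite negbK => /eqP.
(* The 2 bounds the two error terms of [poincare_block], each at most 1 for the choices below. *)
pose k3 := t%:R * (64 / e + 2).
have k30 : 0 < k3 by rewrite mulr_gt0 ?ltr0n // addr_gt0 // divr_gt0.
pose r := 1 + k3 / e.
have r1 : 1 <= r by rewrite lerDl divr_ge0 // ltW.
have rk3 : k3 < r ^+ 2 * e.
  have : k3 < r * e by rewrite /r mulrDl divfK ?gt_eqF //; lra.
  move=> h; apply: lt_le_trans h _; rewrite ler_pM2r // expr2 ler_peMr //; lra.
pose K := 16 * r.
have K0 : 0 <= K by rewrite /K; lra.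
pose M0 := (Num.bound ((t.+1 ^ 2)%:R * (2 * r))).+1.
have M0P : (t.+1 ^ 2)%:R * (2 * r) < M0%:R.
  apply: lt_le_trans (archi_boundP _) _; first by rewrite mulr_ge0 //; lra.
  by rewrite ler_nat.
have M00 : 0 < M0%:R :> R by rewrite ltr0n.
(* This makes M k^2 = 1, which keeps the error bounded, while k M = M0 is as large as [dense_clique]
   asks. *)
pose M := (M0 * M0)%N; pose k : R := M0%:R^-1.
have k0 : 0 < k by rewrite invr_gt0.
have [dim0 dim0P] := small_inner_rare K0 d0.
(* With m = 4N the discretization error N * 4/m^2 is at most 1; the factor 4 is the form required by
   [small_inner_rare]. *)
pose dim := dim0.+1; pose N := (u * u * dim)%N; pose m := (4 * N)%N.
have N0 : (0 < N)%N by rewrite !muln_gt0 u0.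
have m0 : (0 < m)%N by rewrite muln_gt0.
have small := dim0P dim N (leqnSn _) N0.
pose V : finType := ('I_l * block u dim m M t)%type.
have Y0 : (0 < #|{: block u dim m M t}|)%N.
  by rewrite card_prod !card_ffun !card_ord muln_gt0 !expn_gt0 m0.
exists V, (@be_adj R u dim m M t l K); split.
- exact: be_adj_sym.
- by apply: be_adj_irr.
- by rewrite card_prod card_ord muln_gt0 Y0 andbT (leq_trans _ l2).
- exact: be_adj_clique_free.
split=> [S eS|].
  have [|i eA] := sum_in_le_partition _ eS; first by rewrite card_ord (leq_trans _ l2).
  set A := [set v | _] in eA.
  have A0 : A != set0.
    rewrite -card_gt0 -(ltr0n R); apply: lt_le_trans eA.
    by rewrite mulr_gt0 // ltr0n.
  have [||||f [fA fE]] := @dense_clique R u dim m M t' K m0 sgn sgnP k r e A k0 _ _ e0 _ _ A0 eA.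
  - rewrite /k /M natrM mulKf ?gt_eqF //.
  - by [].
  - lra.
  - apply: le_lt_trans rk3; rewrite /k3 ler_pM2l ?ltr0n // lerD2l.
    have -> : M%:R * k ^+ 2 = 1 by rewrite /k /M natrM; field; rewrite gt_eqF.
    rewrite -/N -[leRHS]/(1 + 1) lerD2r.
    rewrite mulrA ler_pdivrMr ?exprn_gt0 ?ltr0n // mul1r /m natrM.
    have : 1 <= N%:R :> R by rewrite ler1n.
    nra.
  exists (fun a => (i, f a)); split=> [a|a b ab].
    by have := fA a; rewrite inE.
  by rewrite /be_adj eqxx; apply: fE.
have cB := card_cross_pairs_ge m0 K0 small.
set B := #|_| in cB.
pose Cs := [set p : block u dim m M t * block u dim m M t | cross_adj K p.1 p.2].
have cE : (l * l.-1 * #|Cs| <= #|[set p : V * V | be_adj K p.1 p.2]|)%N.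
  pose D := [set p : 'I_l * 'I_l | p.1 != p.2].
  have -> : (l * l.-1)%N = #|D|.
    rewrite -sum1_card (eq_bigl (fun p : 'I_l * 'I_l => p.1 != p.2)); last first.
      by move=> p; rewrite inE.
    rewrite -(pair_big_dep xpredT (fun i j : 'I_l => i != j) (fun _ _ => 1))%N /=.
    transitivity (\sum_(i < l) l.-1)%N; first by rewrite sum_nat_const card_ord.
    apply: eq_bigr => i _; rewrite sum1_card.
    transitivity #|predC1 i|; first by rewrite cardC1 card_ord.
    by apply: eq_card => j; rewrite !inE eq_sym.
  rewrite -cardsX.
  pose h (p : ('I_l * 'I_l) * (block u dim m M t * block u dim m M t)) : V * V :=
    ((p.1.1, p.2.1), (p.1.2, p.2.2)).
  have hI : injective h by move=> [[? ?] [? ?]] [[? ?] [? ?]] [-> -> -> ->].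
  rewrite -(card_imset _ hI); apply/subset_leq_card/subsetP => _ /imsetP[[[i j] [y y']] + ->].
  by rewrite !inE /be_adj /= => /andP[/negbTE -> ->].
rewrite -(ler_nat R) in cE; apply: le_trans cE.
have -> : #|V| = (l * (#|{: grid dim m}| ^ (u ^ 2) * #|{: {ffun 'I_M -> 'I_t}}|))%N.
  by rewrite /V !card_prod card_ord card_ffun card_prod !card_ord mulnn.
rewrite /Cs card_cross -/B; apply: density_arith => //; first exact: ltnW.
by apply: divr_ge0; lra.
Qed.

(** * Blow-ups *)

Section BlowUp.
Variables (T1 T2 : finType) (E1 : rel T1) (E2 : rel T2) (N Q r : nat).

(** The vertices of a disjoint union: an N-fold blow-up of [E1], a Q-fold blow-up of [E2] and r
    isolated vertices. *)
Definition blowup_type : finType := ((T1 * 'I_N) + ((T2 * 'I_Q) + 'I_r))%type.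

Definition blowup_rel : rel blowup_type := fun v w =>
  match v, w with
  | inl (x, _), inl (y, _) => E1 x y
  | inr (inl (x, _)), inr (inl (y, _)) => E2 x y
  | _, _ => false
  end.

Lemma blowup_sym : symmetric E1 -> symmetric E2 -> symmetric blowup_rel.
Proof. by move=> s1 s2 [[? ?]|[[? ?]|?]] [[? ?]|[[? ?]|?]] /=. Qed.

Lemma blowup_irr : irreflexive E1 -> irreflexive E2 -> irreflexive blowup_rel.
Proof. by move=> i1 i2 [[? ?]|[[? ?]|?]] /=. Qed.

Lemma card_blowup : #|blowup_type| = (#|T1| * N + (#|T2| * Q + r))%N.
Proof. by rewrite !card_sum !card_prod !card_ord. Qed.

Lemma clique_in_sub (V : finType) (E : rel V) (A B : {set V}) k :
  A \subset B -> clique_in E A k -> clique_in E B k.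
Proof.
move=> /subsetP AB [f [fA fE]]; exists f; split => // i; exact/AB/fA.
Qed.

Lemma blowup_clique (S : {set blowup_type}) k : (2 <= k)%N ->
  clique_in blowup_rel S k ->
  clique_in E1 [set x | [exists a, inl (x, a) \in S]] k \/
  clique_in E2 [set x | [exists a, inr (inl (x, a)) \in S]] k.
Proof.
case: k => // k k2 [f [fS fE]].
case f0: (f ord0) => [[x0 a0]|[[x0 a0]|c0]]; [left|right|].
- have H i : exists p, f i = inl p.
    case: (eqVneq i ord0) => [->|/fE]; first by exists (x0, a0).
    by rewrite f0; case: (f i) => [p _|[[? ?]|?]] //; exists p.
  have [g gP] := fin_all_exists H.
  exists (fun i => (g i).1); split=> [i|i j /fE].
    by rewrite inE; apply/existsP; exists (g i).2; rewrite -surjective_pairing -gP.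
  by rewrite !gP /=; case: (g i) (g j) => ? ? [].
- have H i : exists p, f i = inr (inl p).
    case: (eqVneq i ord0) => [->|/fE]; first by exists (x0, a0).
    by rewrite f0; case: (f i) => [[? ?]|[p _|?]] //; exists p.
  have [g gP] := fin_all_exists H.
  exists (fun i => (g i).1); split=> [i|i j /fE].
    by rewrite inE; apply/existsP; exists (g i).2; rewrite -surjective_pairing -gP.
  by rewrite !gP /=; case: (g i) (g j) => ? ? [].
have /fE : (ord0 : 'I_k.+1) != ord_max by rewrite -val_eqE /=; case: k k2 {f fS fE f0}.
by rewrite f0.
Qed.

Lemma clique_blowupl (S : {set blowup_type}) k :
  clique_in E1 [set x | [exists a, inl (x, a) \in S]] k -> clique_in blowup_rel S k.
Proof.
move=> [f [fS fE]].
have H i : exists a, inl (f i, a) \in S by have := fS i; rewrite inE => /existsP.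
by have [g gP] := fin_all_exists H; exists (fun i => inl (f i, g i)).
Qed.

Lemma clique_blowupr (S : {set blowup_type}) k :
  clique_in E2 [set x | [exists a, inr (inl (x, a)) \in S]] k -> clique_in blowup_rel S k.
Proof.
move=> [f [fS fE]].
have H i : exists a, inr (inl (f i, a)) \in S by have := fS i; rewrite inE => /existsP.
by have [g gP] := fin_all_exists H; exists (fun i => inr (inl (f i, g i))).
Qed.

Lemma blowup_card_le (S : {set blowup_type}) :
  (#|S| <= #|[set x | [exists a, inl (x, a) \in S]]| * N +
     (#|[set x | [exists a, inr (inl (x, a)) \in S]]| * Q + r))%N.
Proof.
have fiber (T : finType) (n : nat) (P : pred (T * 'I_n)) :
    (\sum_(p | P p) 1 <= #|[set x | [exists a, P (x, a)]]| * n)%N.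
  set A := [set x | _].
  have -> : (#|A| * n = #|setX A [set: 'I_n]|)%N by rewrite cardsX cardsT card_ord.
  rewrite -[leqRHS]sum1_card.
  rewrite [leqLHS]big_mkcond [leqRHS]big_mkcond; apply: leq_sum => -[x a] _.
  case: ifP => // Pxa; rewrite !inE /= andbT.
  by have -> : [exists a, P (x, a)] by apply/existsP; exists a.
rewrite -sum1_card big_sumType big_sumType /=; apply: leq_add; first exact: fiber.
apply: leq_add; first exact: fiber.
by rewrite -[r in leqRHS]card_ord -sum1_card [leqLHS]big_mkcond leq_sum // => i _; case: ifP.
Qed.

Lemma blowup_pairs_ge :
  (#|[set p : T1 * T1 | E1 p.1 p.2]| * N ^ 2 <=
   #|[set p : blowup_type * blowup_type | blowup_rel p.1 p.2]|)%N.
Proof.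
have -> : (N ^ 2 = #|[set: 'I_N * 'I_N]|)%N by rewrite cardsT card_prod card_ord mulnn.
rewrite -cardsX.
pose h (p : (T1 * T1) * ('I_N * 'I_N)) : blowup_type * blowup_type :=
  (inl (p.1.1, p.2.1), inl (p.1.2, p.2.2)).
have hI : injective h by move=> [[? ?] [? ?]] [[? ?] [? ?]] [-> -> -> ->].
rewrite -(card_imset _ hI); apply/subset_leq_card/subsetP => _ /imsetP[[[x y] [a b]] + ->].
by rewrite !inE /= andbT.
Qed.

End BlowUp.

(* A bounded number of copies of a graph with smaller independence ratio pays
   for the vertices left over by the division of n by #|T1|. *)
Lemma exists_blowup (R : archiRealFieldType) (s t : nat) (e : R)
    (T1 T2 : finType) (E1 : rel T1) (E2 : rel T2) :
  (2 <= s)%N -> (2 <= t)%N -> 0 < e -> (0 < #|T1|)%N -> (0 < #|T2|)%N ->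
  symmetric E1 -> irreflexive E1 -> symmetric E2 -> irreflexive E2 ->
  ~ clique_in E1 setT s -> ~ clique_in E2 setT s ->
  (forall S, ~ clique_in E1 S t -> #|S|%:R <= e * #|T1|%:R) ->
  (forall S, ~ clique_in E2 S t -> #|S|%:R <= e / 2 * #|T2|%:R) ->
  exists C, forall n, (C <= n)%N -> exists (W : finType) (E : rel W),
    [/\ #|W| = n, symmetric E, irreflexive E, ~ clique_in E setT s &
      (forall S, ~ clique_in E S t -> #|S|%:R <= e * n%:R) /\
      (#|[set p : T1 * T1 | E1 p.1 p.2]| * ((n - C) %/ #|T1|) ^ 2 <=
       #|[set p : W * W | E p.1 p.2]|)%N].
Proof.
move=> s2 t2 e0 n10 n20 sym1 irr1 sym2 irr2 free1 free2 ind1 ind2.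
(* The Q copies of the second graph fall short of the allowed independence ratio e by e/2, which is
   enough to admit up to #|T1| isolated vertices. *)
pose Q := (Num.bound (2 * #|T1|%:R / e)).
have QP : #|T1|%:R <= e / 2 * Q%:R.
  have : 2 * #|T1|%:R / e <= Q%:R.
    by apply/ltW/archi_boundP; rewrite divr_ge0 ?mulr_ge0 // ltW.
  by rewrite ler_pdivrMr //; lra.
exists (#|T2| * Q)%N => n Cn.
pose N := ((n - #|T2| * Q) %/ #|T1|)%N; pose r := ((n - #|T2| * Q) %% #|T1|)%N.
have nE : (n = #|T1| * N + (#|T2| * Q + r))%N.
  by have := divn_eq (n - #|T2| * Q) #|T1|; rewrite -/N -/r mulnC; lia.
exists (blowup_type T1 T2 N Q r), (@blowup_rel T1 T2 E1 E2 N Q r); split.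
- by rewrite card_blowup -nE.
- exact: blowup_sym.
- exact: blowup_irr.
- by case/(blowup_clique s2) => /(clique_in_sub (subsetT _)).
split=> [S Sfree|]; last exact: blowup_pairs_ge.
have h1 := ind1 [set x | [exists a, inl (x, a) \in S]].
have h2 := ind2 [set x | [exists a, inr (inl (x, a)) \in S]].
have := blowup_card_le S; rewrite -(ler_nat R) !natrD !natrM => /le_trans; apply.
rewrite [in leRHS]nE !natrD !natrM.
have {}h1 := h1 (fun H => Sfree (clique_blowupl _ H)).
have {}h2 := h2 (fun H => Sfree (clique_blowupr _ H)).
have {}h1 := ler_wpM2r (ler0n R N) h1.
have {}h2 := ler_wpM2r (ler0n R Q) h2.
have r1 : r%:R <= #|T1|%:R :> R by rewrite ler_nat ltnW // ltn_mod.
have r0 : 0 <= e * r%:R by rewrite mulr_ge0 // ltW.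
have T21 : e / 2 * Q%:R <= e / 2 * #|T2|%:R * Q%:R.
  rewrite -[leRHS]mulrA; apply: ler_wpM2l; first by rewrite divr_ge0 // ltW.
  by rewrite ler_peMl // ler1n.
lra.
Qed.

(** * Simple graphs as relations *)

Section Bridge.
Variable T : finType.

Definition adj (G : sgraph T) : rel T := fun x y => [set x; y] \in edges G.

Lemma adj_sym (G : sgraph T) : symmetric (adj G).
Proof. by move=> x y; rewrite /adj finset.setUC. Qed.

Lemma adj_irr (G : sgraph T) : irreflexive (adj G).
Proof.
move=> x; apply/negP => /(forall_inP (edges_card2 G)).
by rewrite finset.setUid cards1.
Qed.

Lemma contains_completeP (G : sgraph T) s :
  reflect (clique_in (adj G) [set: T] s) (contains (complete s) G).
Proof.
apply: (iffP existsP) => [[f /andP[/injectiveP fI /forall_inP fE]]|[f [_ fE]]].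
  exists f; split=> [i|i j ij]; first by rewrite inE.
  rewrite /adj -[[set f i; f j]]/([set f i; f j]).
  have := fE [set i; j]; rewrite inE cards2 ij => /(_ isT).
  by rewrite imsetU !imset_set1.
have fI : injective f.
  by move=> i j ij; apply/eqP; apply: contraT => /fE; rewrite ij adj_irr.
exists [ffun i => f i]; apply/andP; split.
  by apply/injectiveP => i j; rewrite !ffunE => /fI.
apply/forall_inP => e; rewrite inE => /cards2P[i [j [ij ->]]].
by rewrite imsetU !imset_set1 !ffunE; apply: fE.
Qed.

End Bridge.

Lemma contains_inducedP (T : finType) (G : sgraph T) (S : {set T}) t :
  reflect (clique_in (adj G) S t) (contains (complete t) (induced G S)).
Proof.
apply: (iffP (contains_completeP _ _)) => [[f [_ fE]]|[f [fS fE]]].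
  exists (fun i => val (f i)); split=> [i|i j /fE]; first exact: valP.
  by rewrite /adj inE imsetU !imset_set1.
exists (fun i => exist _ (f i) (fS i)); split=> [i|i j /fE]; first by rewrite inE.
by rewrite /adj [in X in _ -> X]inE imsetU !imset_set1.
Qed.

Lemma set2_eq (T : finType) (a b x y : T) : x != y ->
  ([set a; b] == [set x; y]) = ((a, b) == (x, y)) || ((a, b) == (y, x)).
Proof.
move=> xy; rewrite !xpair_eqE; apply/eqP/orP => [h|[]/andP[/eqP-> /eqP->]].
- have : a \in [set x; y] by rewrite -h !inE eqxx.
  have : b \in [set x; y] by rewrite -h !inE eqxx orbT.
  have := cards2 a b; rewrite h cards2 xy !inE.
  move=> hab /orP[]/eqP e1 /orP[]/eqP e2; move: hab; rewrite e1 e2 !eqxx //= => _.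
    by right.
  by left.
- by [].
- by rewrite finset.setUC.
Qed.

Lemma card_edges (T : finType) (G : sgraph T) :
  #|[set p : T * T | adj G p.1 p.2]| = (2 * #|edges G|)%N.
Proof.
rewrite -sum1_card (partition_big (fun p : T * T => [set p.1; p.2]) (mem (edges G))) /=; last first.
  by move=> p; rewrite inE.
rewrite mulnC -sum_nat_const; apply: eq_bigr => e eG.
have /cards2P[x [y [xy exy]]] := forall_inP (edges_card2 G) e eG.
rewrite sum1_card (_ : #|_| = #|[set (x, y); (y, x)]|).
  by rewrite cards2 xpair_eqE negb_and xy.
apply: eq_card => -[a b]; rewrite [in RHS]inE !finset.in_set1 -set2_eq // -exy.
rewrite unfold_in /= inE /= andbC; case: eqP => //= h.
by rewrite /adj h eG.
Qed.

Section OfRel.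
Variables (T : finType) (E : rel T).
Hypotheses (E_sym : symmetric E) (E_irr : irreflexive E).

Lemma rel_edges_card2 :
  [forall e in [set e : {set T} | [exists x, exists y, (e == [set x; y]) && E x y]],
     #|e| == 2].
Proof.
apply/forall_inP => e; rewrite inE => /existsP[x /existsP[y /andP[/eqP -> xy]]].
rewrite cards2; suff -> : x != y by [].
by apply: contraTneq xy => ->; rewrite E_irr.
Qed.

Definition graph_of_rel : sgraph T := SGraph rel_edges_card2.

Lemma adj_graph_of_rel x y : adj graph_of_rel x y = E x y.
Proof.
rewrite /adj inE; apply/existsP/idP => [[a /existsP[b /andP[/eqP h ab]]]|xy]; last first.
  by exists x; apply/existsP; exists y; rewrite eqxx.
have ab' : a != b by apply: contraTneq ab => ->; rewrite E_irr.
move/eqP: h; rewrite set2_eq // !xpair_eqE => /orP[]/andP[/eqP-> /eqP->] //.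
by rewrite E_sym.
Qed.

End OfRel.

Lemma alpha_leP (R : realType) (T : finType) (G : sgraph T) t (x : R) : 0 <= x ->
  (alpha t G)%:R <= x <->
  forall S : {set T}, ~ clique_in (adj G) S t -> #|S|%:R <= x.
Proof.
move=> x0; split=> [ax S SP|H].
  apply: le_trans ax; rewrite ler_nat.
  by apply: (@leq_bigmax_cond _ _ (fun S : {set T} => #|S|)); apply/contains_inducedP.
rewrite /alpha; elim/big_ind: _ => // [m n mx nx|S /contains_inducedP].
  by rewrite /maxn; case: ifP.
exact: H.
Qed.

Lemma RT_ge (R : realType) (V : finType) (E : rel V) (s t : nat) (x : R) :
  0 <= x -> symmetric E -> irreflexive E -> ~ clique_in E setT s ->
  (forall S, ~ clique_in E S t -> #|S|%:R <= x) ->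
  (#|[set p : V * V | E p.1 p.2]| <= 2 * RT t #|V| (complete s) x)%N.
Proof.
move=> x0 sym irr free ind.
pose E' : rel 'I_#|V| := fun i j => E (enum_val i) (enum_val j).
have sym' : symmetric E' by move=> i j; apply: sym.
have irr' : irreflexive E' by move=> i; apply: irr.
pose G := graph_of_rel irr'.
have GE i j : adj G i j = E' i j by apply: adj_graph_of_rel.
have -> : #|[set p : V * V | E p.1 p.2]| = #|[set p | adj G p.1 p.2]|.
  pose h (p : 'I_#|V| * 'I_#|V|) : V * V := (enum_val p.1, enum_val p.2).
  have hI : injective h.
    by move=> [i j] [i' j'] [] /enum_val_inj -> /enum_val_inj ->.
  rewrite -[RHS](card_imset _ hI); apply: eq_card => -[a b].
  apply/idP/imsetP => [|[[i j] + ->]]; last by rewrite !inE GE.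
  rewrite inE => ab; exists (enum_rank a, enum_rank b).
    by rewrite inE GE /E' !enum_rankK.
  by rewrite /h !enum_rankK.
rewrite card_edges leq_pmul2l //.
apply: (@leq_bigmax_cond _ _ (fun G : sgraph 'I_#|V| => #|edges G|)).
apply/andP; split.
  apply/contains_completeP => -[f [_ fE]]; apply: free.
  by exists (fun i => enum_val (f i)); split=> [i|i j /fE]; rewrite ?inE ?GE.
apply/alpha_leP => // S Sfree; rewrite -(card_imset _ enum_val_inj); apply: ind.
move=> [f [fS fE]]; apply: Sfree.
have H i : exists j, (j \in S) && (f i == enum_val j).
  by have /imsetP[j jS ->] := fS i; exists j; rewrite jS eqxx.
have [g gP] := fin_all_exists H.
exists g; split=> [i|i j /fE]; first by have /andP[] := gP i.
by rewrite GE /E'; have /andP[_ /eqP->] := gP i; have /andP[_ /eqP->] := gP j.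
Qed.

(** The first alternative covers an empty family of graphs, whose maximum is 0 by convention. *)
Lemma RT_witness (R : realType) (n s t : nat) (x : R) : 0 <= x ->
  RT t n (complete s) x = 0%N \/
  exists E : rel 'I_n, [/\ symmetric E, irreflexive E, ~ clique_in E setT s,
    (forall S, ~ clique_in E S t -> #|S|%:R <= x) &
    #|[set p : 'I_n * 'I_n | E p.1 p.2]| = (2 * RT t n (complete s) x)%N].
Proof.
move=> x0; pose P := [pred G : sgraph 'I_n | ~~ contains (complete s) G && ((alpha t G)%:R <= x)].
case: (posnP #|P|) => [P0|/(eq_bigmax_cond (fun G : sgraph 'I_n => #|edges G|))[G GP GE]].
  by left; rewrite /RT big1 // => G GP; have := card0_eq P0 G; rewrite inE GP.
right; exists (adj G); have /andP[/contains_completeP free /(alpha_leP _ _ x0) ind] := GP.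
split; [exact: adj_sym | exact: adj_irr | exact: free | exact: ind |].
by rewrite card_edges -GE.
Qed.

Lemma RT_le_sqr (R : realType) (n s t : nat) (x : R) : (RT t n (complete s) x <= n ^ 2)%N.
Proof.
apply/bigmax_leqP => G _.
have := max_card [set p | adj G p.1 p.2]; rewrite card_edges card_prod !card_ord mulnn.
by apply: leq_trans; rewrite leq_pmull.
Qed.

Lemma RT_mono (R : realType) (n s t : nat) (x y : R) : x <= y ->
  (RT t n (complete s) x <= RT t n (complete s) y)%N.
Proof.
move=> xy; apply/bigmax_leqP => G /andP[free ax].
apply: (@leq_bigmax_cond _ _ (fun G : sgraph 'I_n => #|edges G|)).
by rewrite free (le_trans ax).
Qed.

(** * Limits *)

From mathcomp Require Import all_classical all_reals all_analysis.
Import numFieldNormedType.Exports.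

Lemma RT_blowup_le (R : realType) (t l : nat) (e : R) (n0 : nat) :
  (2 <= t)%N -> (2 <= l)%N -> 0 < e -> (0 < n0)%N ->
  exists C, forall n, (C <= n)%N ->
    (RT t n0 (complete (t + l)) (e * n0%:R) * ((n - C) %/ n0) ^ 2 <=
     RT t n (complete (t + l)) (e * n%:R))%N.
Proof.
move=> t2 l2 e0 n00.
have en0 : 0 <= e * n0%:R by rewrite mulr_ge0 // ltW.
case: (RT_witness n0 (t + l) t en0) => [->|[E [sym irr free ind cE]]]; first by exists 0%N.
have e2 : 0 < e / 2 by rewrite divr_gt0.
have d2 : 0 < (2^-1 : R) < 1 by apply/andP; split; lra.
(* This graph, of independence ratio e/2, pays for the remainder in [exists_blowup]. *)
have [V [F [symF irrF V0 freeF [denseF _]]]] := bollobas_erdos_graph t2 l2 e2 d2.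
have s2 : (2 <= t + l)%N by rewrite (leq_trans t2) // leq_addr.
have In0 : (0 < #|'I_n0|)%N by rewrite card_ord.
have indF (S : {set V}) : ~ clique_in F S t -> #|S|%:R <= e / 2 * #|V|%:R.
  by move=> Sfree; rewrite leNgt; apply/negP => /ltW/denseF.
have ind' (S : {set 'I_n0}) : ~ clique_in E S t -> #|S|%:R <= e * #|'I_n0|%:R.
  by rewrite card_ord; apply: ind.
have [C CP] := exists_blowup s2 t2 e0 In0 V0 sym irr symF irrF free freeF ind' indF.
exists C => n /CP[W [G [<- symG irrG freeG [indG]]]].
rewrite card_ord cE => /leq_trans H.
have {}H := H _ (RT_ge _ symG irrG freeG indG).
by rewrite -(leq_pmul2l (isT : 0 < 2)%N) mulnA H // mulr_ge0 // ltW.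
Qed.

(** The blow-up fills at least n - (C + n0) of the n vertices, so the ratio loses at most the factor
    (1 - (C + n0)/n)^2; as the ratio is at most 1, this costs O(1/n). *)
Lemma RT_ratio_almost_mono (R : realType) (t l : nat) (e : R) (n0 : nat) :
  (2 <= t)%N -> (2 <= l)%N -> 0 < e -> (0 < n0)%N ->
  exists D : R, forall n, (0 < n)%N ->
    (RT t n0 (complete (t + l)) (e * n0%:R))%:R / n0%:R ^+ 2 - D / n%:R <=
    (RT t n (complete (t + l)) (e * n%:R))%:R / n%:R ^+ 2.
Proof.
move=> t2 l2 e0 n00; have [C CP] := RT_blowup_le t2 l2 e0 n00.
pose D : R := (C + n0)%:R; exists (2 * D) => n n_gt0.
have nR : 0 < n%:R :> R by rewrite ltr0n.
have n0R : 0 < n0%:R :> R by rewrite ltr0n.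
set a := _ / n0%:R ^+ 2.
have a0 : 0 <= a by rewrite divr_ge0 ?sqr_ge0.
have a1 : a <= 1.
  by rewrite ler_pdivrMr ?exprn_gt0 // mul1r -natrX ler_nat RT_le_sqr.
(* For smaller n the left-hand side is negative. *)
case: (leqP (C + n0) n) => [Dn|nD]; last first.
  apply: (@le_trans _ _ 0); last by rewrite divr_ge0 ?sqr_ge0.
  have : 1 <= D / n%:R by rewrite ler_pdivlMr // mul1r ler_nat ltnW.
  by rewrite -mulrA; lra.
have Cn : (C <= n)%N by rewrite (leq_trans _ Dn) // leq_addr.
set N := ((n - C) %/ n0)%N in CP *.
have := CP n Cn; rewrite -/N -(ler_nat R) natrM natrX => H.
have N1 : n%:R - D <= n0%:R * N%:R.
  rewrite lerBlDr /D -natrM -natrD ler_nat.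
  have := divn_eq (n - C) n0; rewrite -/N.
  by have := ltn_mod (n - C) n0; rewrite n00; lia.
apply: le_trans (ler_wpM2r _ H); last by rewrite invr_ge0 sqr_ge0.
have -> : (RT t n0 (complete (t + l)) (e * n0%:R))%:R * N%:R ^+ 2 / n%:R ^+ 2 =
    a * (n0%:R * N%:R / n%:R) ^+ 2.
  by rewrite /a; field; rewrite !gt_eqF.
have x1 : 1 - D / n%:R <= n0%:R * N%:R / n%:R.
  by rewrite ler_pdivlMr // mulrBl divfK ?gt_eqF // mul1r.
have x0 : 0 <= 1 - D / n%:R by rewrite subr_ge0 ler_pdivrMr // mul1r ler_nat.
have x2 : (1 - D / n%:R) ^+ 2 <= (n0%:R * N%:R / n%:R) ^+ 2.
  by apply: lerXn2r; rewrite ?nnegrE // divr_ge0 ?mulr_ge0 ?ltW.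
apply: le_trans (ler_wpM2l a0 x2).
have D0 : 0 <= D / n%:R by rewrite divr_ge0 // ltW.
rewrite -mulrA; move: (D / n%:R) D0 x0 => y y0 y1; nra.
Qed.

(** The limit is the supremum over n > 0: a term close to it keeps all far enough terms close. *)
Lemma almost_mono_cvg (R : realType) (a : nat -> R) :
  (forall n, a n <= 1) ->
  (forall n0, (0 < n0)%N -> exists D : R, forall n, (0 < n)%N -> a n0 - D / n%:R <= a n) ->
  exists2 A : R, (a @ \oo --> A)%classic & forall n, (0 < n)%N -> a n <= A.
Proof.
move=> a1 am; pose S := [set a n | n in [set n | (0 < n)%N]]%classic.
have supS : has_sup S.
  by split; [exists (a 1%N), 1%N | exists 1 => _ [n _ <-]].
have aA n : (0 < n)%N -> a n <= sup S.
  by move=> n0; apply: sup_upper_bound => //; exists n.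
exists (sup S) => //; apply/cvgrPdist_le => e e0.
have e2 : 0 < e / 2 by rewrite divr_gt0.
have [_ [n0 /= n00 <-] an0] := sup_adherent e2 supS.
have [D DP] := am n0 n00.
pose m := (Num.bound (2 * `|D| / e)).+1.
exists m => // n /= mn; have n_gt0 : (0 < n)%N by apply: leq_trans mn.
have := DP n n_gt0 => h; rewrite ger0_norm ?subr_ge0 ?aA //.
have : D / n%:R <= e / 2.
  rewrite ler_pdivrMr ?ltr0n //; apply: (le_trans (ler_norm D)).
  have : 2 * `|D| / e <= n%:R.
    apply/ltW/(lt_le_trans (archi_boundP _)); first by rewrite divr_ge0 ?mulr_ge0 ?normr_ge0 // ltW.
    by rewrite ler_nat (leq_trans _ mn).
  by rewrite ler_pdivrMr //; lra.
lra.
Qed.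

Theorem theorem2p1 (R : realType) (t l : nat)
    (ht : (2 <= t)%N) (hl : (2 <= l <= t)%N) :
  let u := uphalf t in
  2^-1 * (1 - l%:R^-1) * 2 ^- (u ^ 2)%N <= theta R t (complete (t + l)%N).
Proof.
pose u := uphalf t; have /andP[l2 _] := hl.
suff : 2^-1 * (1 - l%:R^-1) * 2 ^- (u ^ 2)%N <= theta R t (complete (t + l)%N) by [].
pose a (e : R) (n : nat) := (RT t n (complete (t + l)) (e * n%:R))%:R / n%:R ^+ 2 : R.
have a0 e n : 0 <= a e n by rewrite divr_ge0 ?sqr_ge0.
have a1 e n : a e n <= 1.
  case: n => [|n]; first by rewrite /a expr0n invr0 mulr0.
  by rewrite ler_pdivrMr ?exprn_gt0 ?ltr0n // mul1r -natrX ler_nat RT_le_sqr.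
have cvg_a e : 0 < e ->
    exists2 A : R, (a e @ \oo --> A)%classic & forall n, (0 < n)%N -> a e n <= A.
  by move=> e0; apply: almost_mono_cvg => // n0; apply: RT_ratio_almost_mono.
pose g (e : R) : R := (lim (a e @ \oo))%classic.
have gP e : 0 < e -> (cvgn (a e))%classic /\ forall n, (0 < n)%N -> a e n <= g e.
  move=> /cvg_a[A aA An]; have -> : g e = A by apply: cvg_lim aA.
  by split => //; apply/cvg_ex; exists A.
have g_ge e : 0 < e -> 2^-1 * (1 - l%:R^-1) * 2 ^- (u ^ 2)%N <= g e.
  move=> e0; have [_ ga] := gP e e0.
  have gd (d : R) : 0 < d < 1 ->
      2^-1 * (1 - l%:R^-1) * ((1 - d) / 2) ^+ (u ^ 2) <= g e.
    move=> /(bollobas_erdos_graph ht l2 e0)[V [E [sym irr V0 free [dense pairs]]]].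
    (* The limit dominates every term, so a single graph, at n = #|V|, bounds it from below. *)
    apply: le_trans (ga _ V0).
    have := @RT_ge R V E (t + l) t (e * #|V|%:R) _ sym irr free _.
    rewrite -(ler_nat R) natrM => /(_ _ _)/(le_trans pairs) H.
    rewrite /a ler_pdivlMr ?exprn_gt0 ?ltr0n //.
    have : (1 - l%:R^-1) * ((1 - d) / 2) ^+ (u ^ 2) * #|V|%:R ^+ 2 <=
        2 * (RT t #|V| (complete (t + l)) (e * #|V|%:R))%:R.
      apply: H => [|S Sfree]; first by rewrite mulr_ge0 // ltW.
      by rewrite leNgt; apply/negP => /ltW/dense.
    by rewrite -/u; lra.
  set c := 2^-1 * (1 - l%:R^-1) * 2 ^- (u ^ 2)%N.
  apply/ler_addgt0Pr => h h0; set n := (u ^ 2)%N in gd c *.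
  have l_inv : 0 <= (l%:R^-1 : R) <= 1.
    by rewrite invr_ge0 ler0n /= invf_le1 ?ltr0n ?ler1n ltnW // ltnW.
  have p_inv : 0 <= (2 ^- n : R) <= 1.
    by rewrite invr_ge0 exprn_ge0 //= invf_le1 ?exprn_gt0 // exprn_ege1 // ler1n.
  have c01 : 0 <= c <= 1.
    case/andP: l_inv => l0 l1; case/andP: p_inv => p0 p1; apply/andP; split.
      by rewrite !mulr_ge0 // subr_ge0.
    by apply: mulr_ile1; rewrite ?mulr_ge0 ?subr_ge0 //; lra.
  (* This lies in ]0, 1[ and gives n d <= h, so by Bernoulli's inequality the factor (1 - d)^n costs
     at most h. *)
  pose d := h / (h + n.+1%:R).
  have hn : 0 < h + n.+1%:R by rewrite addr_gt0.
  have d01 : 0 < d < 1.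
    by rewrite divr_gt0 //= ltr_pdivrMr // mul1r ltrDl ltr0n.
  have nd : n%:R * d <= h.
    rewrite /d mulrA ler_pdivrMr // mulrC ler_wpM2l ?ltW // -natr1; lra.
  have := gd d d01.
  have bern : 1 - n%:R * d <= (1 - d) ^+ n.
    case/andP: d01 => d0 d1; elim: (n) => [|k IHk]; first by rewrite mul0r subr0 expr0.
    have dk : 0 <= k%:R * d ^+ 2 by rewrite mulr_ge0 ?sqr_ge0.
    have := ler_wpM2r (ltW (_ : 0 < 1 - d)) IHk.
    by rewrite subr_gt0 -exprSr -natr1 => /(_ d1); lra.
  rewrite expr_div_n mulrCA -/c mulrC => gc.
  have := ler_wpM2l (proj1 (andP c01)) bern; case/andP: c01 => c0 c1; nra.
have g_mono : {in `]0, +oo[ &, {homo g : x y / x <= y}}.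
  move=> x y; rewrite !in_itv /= !andbT => x0 y0 xy.
  apply: ler_lim; [exact: (gP x x0).1 | exact: (gP y y0).1 |].
  apply: nearW => n; rewrite ler_wpM2r ?invr_ge0 ?sqr_ge0 // ler_nat.
  by apply: RT_mono; rewrite ler_wpM2r.
have lb : has_lbound (g @` [set` Interval (BRight (0 : R)) +oo%O])%classic.
  exists 0 => _ [x xI <-]; have : x \in Interval (BRight (0 : R)) +oo%O := xI.
  rewrite in_itv /= andbT => x0.
  by apply: le_trans ((gP x x0).2 1%N _).
(* Monotonicity and the lower bound 0 make the outer limit exist, so the bound on [g] passes to
   it. *)
have g_cvg := nondecreasing_at_right_cvgr (isT : (BRight 0 < +oo)%O) g_mono lb.
apply: limr_ge; first by apply/cvg_ex; eexists; exact: g_cvg.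
near=> x; apply: g_ge; near: x; exact: nbhs_right_gt.
Unshelve. all: by end_near. Qed.
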